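(* Let $\mathcal{T}$ be a tree chosen uniformly at random from the labelled trees on the vertex set $[n]$, and let $c(n)$ be the number of sub-trees of $\mathcal{T}$. Fix $K,\hat{K}\in\mathbb{N}$ with $K<\hat{K}$. For $(T,v)\in\mathcal{F}_k$ with $k\in[K]$, let $g(T,v)$ be the number of sub-trees of $T$ containing $v$, with the empty tree also counted. Let $$f_K(k) := \frac{e^{-k}}{k!} - \sum_{\ell=k+1}^{K} (\ell-k)^{\ell-k-1}\binom{\ell}{\ell-k}\frac{e^{-\ell}}{\ell!},\qquad h(m):=1-\sum_{k=1}^{m}\frac{(k/e)^k}{k\cdot k!}.$$ Then asymptotically almost surely $c(n)\le(\xi_1\xi_2\xi_3\xi_4+o(1))^n$, where $o(1)\to0$ as $n\to\infty$ and $$\xi_1=\left(\frac{\hat K+1}{\hat K}\right)^{h(\hat K)},\quad \xi_2=\prod_{k=K+1}^{\hat K}\left(\frac{k+1}{k}\right)^{k(k-1)^{k-2}e^{-k}/k!},$$ $$\xi_3=\prod_{k=K+1}^{\hat K}\left(\frac{2k-1}{2k-2}\right)^{(k^{k-1}-k(k-1)^{k-2})e^{-k}/k!},\quad \xi_4=\prod_{k=1}^K\prod_{(T,v)\in\mathcal{F}_k} g(T,v)^{f_K(k)}.$$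
   Context: For $k\in\mathbb{N}$, $\mathcal{F}_k$ is the family of rooted labelled trees on $[k]$, i.e. pairs $(T,v)$ with $T$ a labelled tree on $[k]$ and $v\in[k]$. A sub-tree is a non-empty vertex subset inducing a connected subgraph. Equivalently, $g(K_1,v)=2$ and $g(T,v)=1+\prod_{w\in N(v)} g(S(T,v,w),w)$, where $S(T,v,w)$ is the component of $T-vw$ containing $w$. An event holds asymptotically almost surely if its probability tends to $1$ as $n\to\infty$. *)

(* Defs.v *)
From HB Require Import structures.
From mathcomp Require Import all_boot all_order all_algebra.
From mathcomp Require Import all_classical all_reals all_analysis.

Set Implicit Arguments.
Unset Strict Implicit.
Unset Printing Implicit Defensive.

Import Order.TTheory GRing.Theory Num.Theory.
Import numFieldNormedType.Exports.

Local Open Scope ring_scope.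

(* A graph on the finite vertex type V is given by its edge set, a set of
   unordered pairs; the vertex set [n] is rendered by 'I_n. *)

Definition simple (V : finType) (E : {set {set V}}) : Prop :=
  forall e : {set V}, e \in E -> #|e| = 2.

Definition adj (V : finType) (E : {set {set V}}) : rel V :=
  fun x y => [set x; y] \in E.

(* A repetition-free closed walk with at least three vertices is a cycle; an
   edge traversed back and forth is a ucycle of size 2, hence the bound. *)
Definition acyclic (V : finType) (E : {set {set V}}) : Prop :=
  forall c : seq V, ucycle (adj E) c -> (size c <= 2)%N.

Definition connected_in (V : finType) (E : {set {set V}}) (S : {set V}) : bool :=
  [forall x in S, forall y in S,
     connect (fun a b => [&& a \in S, b \in S & adj E a b]) x y].

Definition is_tree (V : finType) (E : {set {set V}}) : Prop :=
  [/\ simple E, (0 < #|V|)%N, connected_in E [set: V] & acyclic E].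

Definition trees (n : nat) : {set {set {set 'I_n}}} :=
  [set E | `[< is_tree E >]].

Definition rooted_trees (k : nat) : {set {set {set 'I_k}} * 'I_k} :=
  [set Tv | Tv.1 \in trees k].

Definition subtree (V : finType) (E : {set {set V}}) (S : {set V}) : bool :=
  (S != finset.set0) && connected_in E S.

Definition num_subtrees (V : finType) (E : {set {set V}}) : nat :=
  #|[set S : {set V} | subtree E S]|.

(* The summand 1 counts the empty tree. *)
Definition num_rooted_subtrees (V : finType) (E : {set {set V}}) (v : V) : nat :=
  (#|[set S : {set V} | subtree E S & v \in S]| + 1)%N.

(* Probability of the event A under the uniform distribution on trees n. *)
Definition tree_prob (R : realType) (n : nat) (A : pred {set {set 'I_n}}) : R :=
  #|[set E in trees n | A E]|%:R / #|trees n|%:R.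

Definition aas (R : realType) (A : forall n : nat, pred {set {set 'I_n}}) : Prop :=
  ((fun n : nat => tree_prob R (A n)) @ \oo --> (1 : R))%classic.

Definition fK (R : realType) (K k : nat) : R :=
  expR (- k%:R) / k`!%:R
  - \sum_(k.+1 <= l < K.+1)
      (l - k)%:R ^+ (l - k - 1) * 'C(l, l - k)%:R * (expR (- l%:R) / l`!%:R).

Definition hfun (R : realType) (m : nat) : R :=
  1 - \sum_(1 <= k < m.+1) (k%:R / expR 1) ^+ k / (k%:R * k`!%:R).

Definition xi1 (R : realType) (Kh : nat) : R :=
  ((Kh%:R + 1) / Kh%:R) `^ hfun R Kh.

Definition xi2 (R : realType) (K Kh : nat) : R :=
  \prod_(K.+1 <= k < Kh.+1)
    ((k%:R + 1) / k%:R)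
      `^ (k%:R * (k%:R - 1) ^+ (k - 2) * expR (- k%:R) / k`!%:R).

Definition xi3 (R : realType) (K Kh : nat) : R :=
  \prod_(K.+1 <= k < Kh.+1)
    ((2 * k%:R - 1) / (2 * k%:R - 2))
      `^ ((k%:R ^+ (k - 1) - k%:R * (k%:R - 1) ^+ (k - 2))
          * expR (- k%:R) / k`!%:R).

Definition xi4 (R : realType) (K : nat) : R :=
  \prod_(1 <= k < K.+1) \prod_(Tv in rooted_trees k)
    (num_rooted_subtrees Tv.1 Tv.2)%:R `^ fK R K k.

(* Main.v *)
(* Root the tree at [r] and describe it by its parent function [f].  Let [s v] be
   the number of subtrees whose vertex closest to the root is [v], and
   [g v = s v + 1].  Since [s v] is the product of [g w] over the children [w]
   of [v], the product of [g v / s v] over all vertices telescopes to [g r], while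
   the number of subtrees, the sum of the [s v], is at most [n * s r].  Hence
   [ln c(n)] is at most [ln n] plus the sum over [v] of [ln (g v / s v)].  A vertex
   whose fringe subtree (the set of its descendants) has [k] vertices satisfies
   [s v >= k], and [s v >= 2 (k - 1)] unless it has exactly one child; this bounds
   the summands with [k > K], while those with [k <= K] are kept.  The resulting sum
   depends only on how often each rooted tree with at most [Kh] vertices occurs as a
   fringe subtree.  By Cayley's formula for forests and a second moment computation,
   the number of copies of a given labelled tree on [k] vertices, divided by [n],
   tends to [exp (- k) / k!] in mean square, and summing these limits gives
   [ln (xi1 xi2 xi3 xi4)]. *)

Require Import Defs.
From mathcomp Require Import all_boot all_order all_algebra.
From mathcomp Require Import all_classical all_reals all_analysis.
From mathcomp Require Import zify ring lra.
(* Re-imported because the analysis library shadows several lemmas on finite sets. *)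
From mathcomp Require Import fintype finset.

Set Implicit Arguments.
Unset Strict Implicit.
Unset Printing Implicit Defensive.

Import Order.TTheory GRing.Theory Num.Theory.
Import numFieldNormedType.Exports.

(** * Forests and Cayley's formula *)

Section Forests.
Variable V : finType.
Implicit Types (f h : {ffun V -> V}) (A B C D S : {set V}) (x y r u v w : V).

(** Any vertex [r] may serve as the root: [edges r] maps [treefun r] bijectively onto the labelled
    trees, so the uniform distribution passes to parent functions, and expectations become sums over
    [treefun r] with bounds uniform in [r]. A copy of a tree is counted through an embedding [iota]:
    it prescribes [f] on its image and leaves an arbitrary tree on the complement, so both moments
    reduce to counting forests. The second moment is tractable because fringe subtrees are nested or
    disjoint; two copies of one tree have equal size, hence are disjoint or have the same image.
    Origin of the constants: there are k^(k-1) rooted labelled trees on k vertices, so (k/e)^k / (k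
    k!) is the limiting proportion of vertices whose fringe subtree has size k, and [hfun] is the
    proportion left for larger sizes. The subtracted sum in [fK] appears because ln s is itself a
    sum of terms ln g over smaller fringe subtrees. The second moment yields a bound for each fixed
    eps only; a diagonal choice of eps produces the single o(1). *)

Definition reaches f A x := [exists a in A, fconnect f x a].

Lemma reachesP f A x : reflect (exists j, iter j f x \in A) (reaches f A x).
Proof.
apply: (iffP exists_inP) => [[a aA xa]|[j jA]].
  by exists (findex f x a); rewrite iter_findex.
by exists (iter j f x) => //; exact: fconnect_iter.
Qed.

Lemma reaches0 f A x : x \in A -> reaches f A x.
Proof. by move=> xA; apply/reachesP; exists 0. Qed.

Lemma reachesS f A x : reaches f A (f x) -> reaches f A x.
Proof. by move=> /reachesP[j jA]; apply/reachesP; exists j.+1; rewrite iterSr. Qed.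

Lemma reaches_ind f A (P : V -> Prop) :
  (forall x, x \in A -> P x) -> (forall x, P (f x) -> P x) ->
  forall x, reaches f A x -> P x.
Proof.
move=> P0 PS x /reachesP[j]; elim: j x => [|j IH] x; first exact: P0.
by rewrite iterSr => /IH; exact: PS.
Qed.

(* Forests on [A :|: B] with root set [A], encoded by parent functions that are the
   identity outside [B]; locked so that [inE] does not unfold membership. *)
Definition forest A B : {set {ffun V -> V}} := locked
  [set f : {ffun V -> V} |
    [forall x, if x \in B then (f x \in A :|: B) && reaches f A x
               else f x == x]].

Lemma forestP f A B :
  reflect [/\ forall x, x \notin B -> f x = x,
              forall x, x \in B -> f x \in A :|: B
            & forall x, x \in B -> reaches f A x]
          (f \in forest A B).
Proof.
rewrite /forest -lock inE; apply: (iffP forallP) => [H|[H1 H2 H3] x].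
  split=> x xB; have := H x; rewrite ?(negPf xB) ?xB.
  - by move/eqP.
  - by case/andP.
  - by case/andP.
case: ifPn => xB; last by rewrite H1.
by rewrite H2 ?H3.
Qed.

(** Being the identity outside [D] matches the convention of [forest], so a restricted parent
    function can itself be a forest. *)
Definition restr D f : {ffun V -> V} := [ffun x => if x \in D then f x else x].

(** Such an [f] is the same as a pair of independent restrictions, a free choice on [S] and a member
    of [H] on [D]. This is the common core of peeling off one level of a forest and of cutting
    copies of a tree out of a larger tree. *)
Lemma card_glue S D (P : V -> {set V}) (H X : {set {ffun V -> V}}) :
  [disjoint S & D] ->
  (forall h, h \in H -> forall x, x \notin D -> h x = x) ->
  (forall f, f \in X <->
    [/\ forall x, x \notin S :|: D -> f x = x,
        forall x, x \in S -> f x \in P x & restr D f \in H]) ->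
  #|X| = (\prod_(x in S) #|P x|) * #|H|.
Proof.
move=> dSD Hid HX.
have SD x : x \in S -> x \in D = false by move/(disjointFr dSD).
pose F x : {pred V} := [pred y | if x \in S then y \in P x else y == x].
have -> : \prod_(x in S) #|P x| = #|family F|.
  rewrite card_family foldrE big_image /= big_mkcond /=; apply: eq_bigr => x _.
  rewrite /F; case: ifP => xS.
    by apply: eq_card => y; rewrite inE.
  by rewrite -(card1 x); apply: eq_card => y; rewrite !inE.
rewrite -(cardsE (family F)) -cardsX.
have inj : {in X &, injective (fun f => (restr S f, restr D f))}.
  move=> f f' /HX[f0 _ _] /HX[f0' _ _] [/ffunP eS /ffunP eD]; apply/ffunP => x.
  have := eS x; have := eD x; rewrite !ffunE.
  case: ifP => xD //; case: ifP => xS // _ _.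
  by rewrite f0 ?f0' // !inE xS xD.
rewrite -(card_in_imset inj); apply: eq_card => -[f1 f2]; rewrite in_setX inE /=.
apply/imsetP/andP => [[f /HX[f0 fS fD] [-> ->]]|[/familyP f1F f2H]].
  split=> //; apply/familyP => x; rewrite inE ffunE; case: ifP => xS; rewrite ?xS //.
  exact: fS.
exists [ffun x => if x \in S then f1 x else f2 x]; last first.
  congr pair; apply/ffunP => x; rewrite !ffunE.
    by case: ifP => // xS; have := f1F x; rewrite inE xS => /eqP.
  case: ifP => [xD|/negbT xD]; first by rewrite (disjointFl dSD).
  exact: Hid.
apply/HX; split=> [x|x xS|].
- by rewrite !inE negb_or ffunE => /andP[/negPf-> xD]; exact: Hid.
- by have := f1F x; rewrite ffunE inE xS.
rewrite (_ : restr _ _ = f2) //; apply/ffunP => x; rewrite !ffunE.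
case: ifP => [xD|/negbT xD]; first by rewrite (disjointFl dSD).
by rewrite Hid.
Qed.


(** Here [C] is the set of children of the roots. Each of them picks its parent in [A] freely, and
    once [A] is deleted they are the roots of a forest on the rest of [B]. *)
Lemma card_forest_level A B C : [disjoint A & B] -> C \subset B ->
  #|[set f in forest A B | [set x in B | f x \in A] == C]| =
  #|A| ^ #|C| * #|forest C (B :\: C)|.
Proof.
move=> dAB CB; set D := B :\: C.
have CBx x : x \in C -> x \in B by apply: (subsetP CB).
have BE x : (x \in B) = (x \in C) || (x \in D).
  by rewrite inE; case: (boolP (x \in C)) => //= /CBx.
have DC x : x \in D -> x \in C = false by rewrite inE => /andP[/negPf].
have DB x : x \in D -> x \in B by rewrite BE orbC => ->.
have dCD : [disjoint C & D].
  by rewrite -setI_eq0; apply/eqP/setP => x; rewrite !inE; case: (x \in C).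
rewrite -prod_nat_const; apply: card_glue dCD _ _ => [h /forestP[] //|f].
have rE x : x \in D -> restr D f x = f x by rewrite ffunE => ->.
rewrite inE; split.
  case/andP=> /forestP[f0 f1 f2] /eqP/setP fC.
  have {}fC x : x \in B -> (f x \in A) = (x \in C).
    by move=> xB; rewrite -fC inE xB.
  split=> [x|x xC|].
  - by rewrite in_setU -BE => /f0.
  - by rewrite fC ?CBx.
  have fD x : x \in D -> f x \in B.
    by move=> xD; have := f1 x (DB x xD); rewrite inE (fC _ (DB _ xD)) (DC _ xD).
  apply/forestP; split=> [x xD|x xD|x xD].
  - by rewrite ffunE (negPf xD).
  - by rewrite rE // inE -BE fD.
  have := f2 _ (DB _ xD); move: xD => /[swap]; move: x.
  apply: reaches_ind => [x xA|x IH] xD.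
    by have := DB x xD; rewrite (disjointFr dAB xA).
  apply: reachesS; rewrite rE //; have := fD x xD; rewrite BE => /orP[|/IH //].
  exact: reaches0.
case=> f0 fC /forestP[_ h1 h2].
have fD x : x \in D -> f x \in B.
  by move=> xD; have := h1 x xD; rewrite rE // inE -BE.
have fCr x : x \in C -> reaches f A x.
  by move=> xC; apply: reachesS; apply: reaches0; exact: fC.
apply/andP; split.
  apply/forestP; split=> x.
  - by rewrite BE -in_setU => /f0.
  - by rewrite inE BE => /orP[/fC->//|/fD ->]; rewrite orbT.
  rewrite BE => /orP[/fCr //|xD]; have := h2 _ xD; move: xD => /[swap]; move: x.
  apply: reaches_ind => [x xC|x IH] xD; first exact: fCr.
  move: IH; rewrite rE // => IH; apply: reachesS.
  by have := fD x xD; rewrite BE => /orP[/fCr|/IH].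
apply/eqP/setP => x; rewrite inE BE.
have [xC|xC] := boolP (x \in C); first by rewrite fC.
apply/negP => /andP[/= xD fA].
by have := fD x xD; rewrite (disjointFr dAB fA).
Qed.

(* The binomial identity behind the recursion on levels in [card_forest]. *)
Lemma sum_subsets_card B a b :
  \sum_(C : {set V} | C \subset B) #|C| * (a ^ #|C| * b ^ (#|B| - #|C|)) =
  a * #|B| * (a + b) ^ #|B|.-1.
Proof.
rewrite (partition_big (fun C : {set V} => inord #|C| : 'I_#|B|.+1) xpredT) //=.
have -> : \sum_(j < #|B|.+1) \sum_(C : {set V} | (C \subset B) && (inord #|C| == j))
    #|C| * (a ^ #|C| * b ^ (#|B| - #|C|)) =
    \sum_(j < #|B|.+1) 'C(#|B|, j) * (j * (a ^ j * b ^ (#|B| - j))).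
  apply: eq_bigr => j _; rewrite -cards_draws -[RHS]sum_nat_const.
  apply: eq_big => C.
    rewrite inE; apply: andb_id2l => CB.
    by rewrite -val_eqE /= inordK // ltnS subset_leq_card.
  case/andP=> CB; rewrite -val_eqE /= inordK ?ltnS ?subset_leq_card //.
  by move/eqP->.
case: #|B| => [|n]; first by rewrite big_ord1 !muln0 mul0n.
rewrite big_ord_recl mul0n muln0 add0n expnDn !big_distrr /=.
rewrite (reindex_inj rev_ord_inj) /=; apply: eq_bigr => i _.
(* Absorption, j C(n, j) = n C(n-1, j-1), removes the weight j and leaves the binomial expansion of
   (a + b)^(n-1). *)
rewrite /bump /= add1n !subSS subKn ?leq_ord // mulnA (mulnC _ (n - i).+1) -mul_bin_diag /=.
by rewrite bin_sub ?leq_ord // expnS; nia.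
Qed.

(** Cayley's formula |A| (|A| + |B|)^(|B| - 1), multiplied by |A| + |B| so that no exponent is
    negative when [B] is empty. The induction removes the children of the roots. *)
Lemma card_forest A B : [disjoint A & B] ->
  (#|A| + #|B|) * #|forest A B| = #|A| * (#|A| + #|B|) ^ #|B|.
Proof.
move: {2}#|B| (leqnn #|B|) => m; elim: m A B => [|m IH] A B Bm dAB.
  move: Bm; rewrite leqn0 cards_eq0 => /eqP->.
  rewrite cards0 expn0 addn0; congr (_ * _).
  have -> : forest A set0 = [set [ffun x => x]]; last by rewrite cards1.
  apply/setP => f; rewrite in_set1; apply/forestP/eqP => [[f0 _ _]|->].
    by apply/ffunP => x; rewrite ffunE f0 ?inE.
  by split=> x; rewrite ?inE ?ffunE.
have [B0|Bn0] := posnP #|B|; first by apply: IH; rewrite ?B0.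
(* For root set [C] the induction hypothesis carries the factor |C| + |B \ C| = |B|, which has to be
   supplied first. *)
apply/eqP; rewrite -(eqn_pmul2l Bn0); apply/eqP.
have -> : #|forest A B| = \sum_(C : {set V} | C \subset B)
            #|A| ^ #|C| * #|forest C (B :\: C)|.
  rewrite -sum1_card.
  rewrite (partition_big (fun f : {ffun V -> V} => [set x in B | f x \in A])
             (fun C : {set V} => C \subset B)) /=.
    apply: eq_bigr => C CB; rewrite -card_forest_level // -sum1_card.
    by apply: eq_bigl => f; rewrite !inE.
  by move=> f _; apply/subsetP => x; rewrite inE => /andP[].
rewrite mulnCA big_distrr /=.
have -> : \sum_(C : {set V} | C \subset B) #|B| * (#|A| ^ #|C| * #|forest C (B :\: C)|)
   = \sum_(C : {set V} | C \subset B) #|C| * (#|A| ^ #|C| * #|B| ^ (#|B| - #|C|)).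
  apply: eq_bigr => C CB.
  have BC : #|B| = #|C| + #|B :\: C| by rewrite -(cardsID C B) (setIidPr CB).
  have [C0|C0] := posnP #|C|.
    move/eqP: C0; rewrite cards_eq0 => /eqP->; rewrite setD0 cards0 mul0n.
    rewrite (_ : forest _ _ = set0) ?cards0 ?muln0 //.
    apply/setP => f; rewrite in_set0; apply/negP => /forestP[_ _ f2].
    have [x xB] : exists x, x \in B by apply/set0Pn; rewrite -card_gt0.
    by have /exists_inP[y] := f2 x xB; rewrite inE.
  rewrite mulnCA {1}BC IH.
  - by rewrite -BC cardsD (setIidPr CB); nia.
  - by rewrite -ltnS; apply: leq_trans Bm; rewrite BC; lia.
  by rewrite -setI_eq0; apply/eqP/setP => x; rewrite !inE; case: (x \in C).
rewrite sum_subsets_card.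
by case: #|B| Bn0 => // b _ /=; rewrite expnS; nia.
Qed.
End Forests.

(** * Fringe subtrees of a parent function *)

Section Fringe.
Variable V : finType.
Implicit Types (f : {ffun V -> V}) (S : {set V}) (r u v w x y : V).

Definition treefun r : {set {ffun V -> V}} := forest [set r] [set~ r].

Lemma treefunP f r :
  reflect (f r = r /\ forall x, reaches f [set r] x) (f \in treefun r).
Proof.
apply: (iffP (forestP _ _ _)) => [[f0 _ f2]|[f0 f2]].
  split=> [|x]; first by rewrite f0 // !inE eqxx.
  have [->|xr] := eqVneq x r; first by apply: reaches0; rewrite inE.
  by apply: f2; rewrite !inE.
split=> x //; rewrite !inE; first by rewrite negbK => /eqP->.
by rewrite orbN.
Qed.

(** Cayley's n^(n-2), with one factor n moved to the left. *)
Lemma card_treefun r : #|V| * #|treefun r| = #|V| ^ #|V|.-1.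
Proof.
have dis : [disjoint [set r] & [set~ r]].
  by rewrite -setI_eq0; apply/eqP/setP => x; rewrite !inE andbN.
have := card_forest dis; rewrite cardsC1 cards1 mul1n add1n prednK //.
by apply/card_gt0P; exists r.
Qed.

Definition fringe f v : {set V} := [set u | fconnect f u v].

Definition children f v : {set V} := [set w | (w != v) && (f w == v)].

(* The subtrees with topmost vertex [v]; [f u != u] says that [u] is not the root. *)
Definition rsub f v : {set {set V}} :=
  [set S : {set V} | (v \in S) &&
    [forall u in S, (u != v) ==> ((f u != u) && (f u \in S))]].

Lemma rsubP f v S :
  reflect (v \in S /\ forall u, u \in S -> u != v -> f u != u /\ f u \in S)
          (S \in rsub f v).
Proof.
rewrite inE; apply: (iffP andP) => -[vS H]; split=> //.
  move=> u uS uv; have /forall_inP/(_ u uS) := H.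
  by rewrite uv => /andP.
apply/forall_inP => u uS; apply/implyP => uv; apply/andP; exact: H.
Qed.

Lemma fringe_id f v : v \in fringe f v.
Proof. by rewrite inE connect0. Qed.

Lemma fringe_trans f u v w : u \in fringe f v -> v \in fringe f w -> u \in fringe f w.
Proof. by rewrite !inE; exact: connect_trans. Qed.

Lemma fringe_step f u : u \in fringe f (f u).
Proof. by rewrite inE fconnect1. Qed.

Lemma fringe_iter f u v : reflect (exists j, iter j f u = v) (u \in fringe f v).
Proof.
rewrite inE; apply: (iffP idP) => [uv|[j <-]]; last exact: fconnect_iter.
by exists (findex f u v); rewrite iter_findex.
Qed.

Lemma fringeS f u v : u \in fringe f v -> u != v -> f u \in fringe f v.
Proof.
case/fringe_iter=> -[/= ->|j]; first by rewrite eqxx.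
by rewrite iterSr => jv _; apply/fringe_iter; exists j.
Qed.

(** Both [v] and [w] lie on the path of ancestors of [u], which is a chain. *)
Lemma fringe_total f u v w : u \in fringe f v -> u \in fringe f w ->
  (v \in fringe f w) || (w \in fringe f v).
Proof.
move=> /fringe_iter[i <-] /fringe_iter[j <-]; apply/orP.
case: (leqP i j) => ij; [left|right]; apply/fringe_iter.
  by exists (j - i); rewrite -iterD subnK.
by exists (i - j); rewrite -iterD subnK // ltnW.
Qed.

Lemma fringe_ind f v (P : V -> Prop) :
  P v -> (forall u, u != v -> P (f u) -> P u) -> forall u, u \in fringe f v -> P u.
Proof.
move=> P0 PS u /fringe_iter[j]; elim: j u => [|j IH] u; first by move=> /= ->.
by rewrite iterSr => /IH; have [->//|uv] := eqVneq u v; exact: PS.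
Qed.

Section Tree.
Variables (r : V) (f : {ffun V -> V}).
Hypothesis fT : f \in treefun r.

Lemma treefun_root : f r = r. Proof. by case/treefunP: fT. Qed.

Lemma treefun_fringe x : x \in fringe f r.
Proof.
case/treefunP: fT => _ /(_ x) /exists_inP[a]; rewrite inE => /eqP->.
by rewrite inE.
Qed.

Lemma treefun_ind (P : V -> Prop) :
  P r -> (forall x, x != r -> P (f x) -> P x) -> forall x, P x.
Proof. by move=> P0 PS x; apply: fringe_ind P0 PS x (treefun_fringe x). Qed.

Lemma treefun_fix x : (f x == x) = (x == r).
Proof.
apply/eqP/eqP => [|->]; last exact: treefun_root.
by move: x; apply: treefun_ind => // x xr IH xx; rewrite !xx in IH; exact: IH.
Qed.

Lemma fringe_root v : r \in fringe f v -> v = r.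
Proof.
case/fringe_iter => j <-; elim: j => //= j ->; exact: treefun_root.
Qed.

(** Induction towards the root: distinct mutual descendants would give [f u = v] and then [f u = u],
    which only the root satisfies. *)
Lemma fringe_anti u v : u \in fringe f v -> v \in fringe f u -> u = v.
Proof.
move: u v; apply: treefun_ind => [v /fringe_root-> //|u ur IH v uv vu].
have [//|nuv] := eqVneq u v.
have fuv : f u = v.
  apply: IH; first exact: fringeS.
  exact: fringe_trans vu (fringe_step f u).
by have /eqP := IH u ltac:(by rewrite fuv) (fringe_step f u);
  rewrite treefun_fix (negPf ur).
Qed.

Lemma fringe_child v w : w \in children f v -> w \in fringe f v.
Proof. by rewrite inE => /andP[_ /eqP <-]; exact: fringe_step. Qed.

Lemma notin_fringe_child v w : w \in children f v -> v \notin fringe f w.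
Proof.
move=> wv; apply/negP => vw; have := fringe_anti vw (fringe_child wv).
by move: wv; rewrite inE => /andP[wv _] vw'; rewrite vw' eqxx in wv.
Qed.

Lemma fringe_children_disjoint v w w' u : w \in children f v ->
  w' \in children f v -> u \in fringe f w -> u \in fringe f w' -> w = w'.
Proof.
move=> + + uw uw'; wlog ww : w w' uw uw' / w \in fringe f w'.
  move=> H wc wc'; case/orP: (fringe_total uw uw') => ww; first exact: H.
  by apply/esym; exact: H.
move=> wc wc'; apply/eqP; apply/negPn/negP => nww.
have := fringeS ww nww.
move: (wc); rewrite inE => /andP[_ /eqP->] vw'.
by have := notin_fringe_child wc'; rewrite vw'.
Qed.

Lemma fringeE v : fringe f v = v |: \bigcup_(w in children f v) fringe f w.
Proof.
apply/setP => u; rewrite in_setU1; apply/idP/orP.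
  apply: (fringe_ind (P := fun u => u == v \/ u \in _)); first by left.
  move=> {}u uv [/eqP fu|/bigcupP[w wc uw]]; right; apply/bigcupP.
    by exists u; rewrite ?fringe_id // inE uv fu eqxx.
  by exists w => //; exact: fringe_trans (fringe_step f u) uw.
case=> [/eqP->|/bigcupP[w wc uw]]; first exact: fringe_id.
exact: fringe_trans uw (fringe_child wc).
Qed.

Lemma card_fringe v : #|fringe f v| = (\sum_(w in children f v) #|fringe f w|).+1.
Proof.
rewrite {1}fringeE cardsU1 (_ : v \notin _); last first.
  apply/bigcupP => -[w wc vw].
  by have := notin_fringe_child wc; rewrite vw.
rewrite add1n; congr _.+1; rewrite -sum1_card; under [RHS]eq_bigr do rewrite -sum1_card.
rewrite (exchange_big_dep (mem (\bigcup_(w in children f v) fringe f w))) /=.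
  apply: eq_bigr => u /bigcupP[w wc uw]; rewrite (big_pred1 w) // => w' /=.
  apply/andP/eqP => [[wc' uw']|-> //].
  exact: fringe_children_disjoint wc' wc uw' uw.
by move=> w u wc uw; apply/bigcupP; exists w.
Qed.

Lemma card_fringe_child v w : w \in children f v -> #|fringe f w| < #|fringe f v|.
Proof. by move=> wc; rewrite (card_fringe v) (bigD1 w) //= ltnS leq_addr. Qed.

Lemma rsub_fringe v S : S \in rsub f v -> S \subset fringe f v.
Proof.
case/rsubP => vS SP; apply/subsetP; apply: treefun_ind => [rS|u ur IH uS].
  have [->|rv] := eqVneq r v; first exact: fringe_id.
  by have [] := SP r rS rv; rewrite treefun_root eqxx.
have [->|uv] := eqVneq u v; first exact: fringe_id.
by apply: fringe_trans (fringe_step f u) (IH _); case: (SP u uS uv).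
Qed.

Lemma rsub_cap v w S : S \in rsub f v -> w \in children f v ->
  S :&: fringe f w \in set0 |: rsub f w.
Proof.
move=> /rsubP[vS SP] wc; rewrite in_setU1.
have wv u : u \in fringe f w -> u != v.
  by apply: contraTneq => ->; exact: notin_fringe_child.
have [//|/= [u]] := set_0Vmem (S :&: fringe f w); first by move->; rewrite eqxx.
rewrite inE => /andP[uS uw]; apply/orP; right.
apply/rsubP; split=> [|x].
  rewrite inE fringe_id andbT; move: u uw (uw) uS.
  apply: fringe_ind => // u uw IH uf uS; apply: IH; first exact: fringeS.
  by case: (SP u uS (wv u uf)).
rewrite !in_setI => /andP[xS xw] nxw; have [-> ->] := SP x xS (wv x xw).
by split=> //; exact: fringeS.
Qed.

(** A member of [rsub f v] is [v] together with independent traces on the fringe subtrees of the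
    children; each trace is empty, counted by the successor, or a member of [rsub f w]. This is the
    recursion for g. *)
Lemma card_rsub v : #|rsub f v| = \prod_(w in children f v) #|rsub f w|.+1.
Proof.
pose F w : {pred {set V}} := mem (set0 |: rsub f w).
have notin0 w : set0 \notin rsub f w by apply/negP => /rsubP[]; rewrite inE.
transitivity #|pfamily set0 (mem (children f v)) F|; last first.
  rewrite card_pfamily foldrE big_image; apply: eq_bigr => w _.
  rewrite -[LHS]/(#|set0 |: rsub f w|).
  by rewrite cardsU1 notin0.
pose G (phi : {ffun V -> {set V}}) := v |: \bigcup_(w in children f v) phi w.
have FP phi w : phi \in pfamily set0 (mem (children f v)) F ->
    w \in children f v -> phi w \in set0 |: rsub f w.
  by case/pfamilyP => _ H wc; exact: (H w wc).
have Ffr phi w u : phi \in pfamily set0 (mem (children f v)) F ->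
    w \in children f v -> u \in phi w -> u \in fringe f w.
  move=> phiF wc; have := FP _ _ phiF wc; rewrite in_setU1 => /orP[/eqP->|].
    by rewrite inE.
  by move/rsub_fringe/subsetP; exact.
have GK phi w : phi \in pfamily set0 (mem (children f v)) F ->
    w \in children f v -> G phi :&: fringe f w = phi w.
  move=> phiF wc; apply/setP => u; rewrite in_setI in_setU1.
  apply/andP/idP => [[/orP[/eqP->|/bigcupP[w' wc' uw'] uw]]|uw].
  - by rewrite (negPf (notin_fringe_child wc)).
  - by rewrite (fringe_children_disjoint wc wc' uw (Ffr _ _ _ phiF wc' uw')).
  split; last exact: Ffr uw.
  by apply/orP; right; apply/bigcupP; exists w.
have Ginj : {in pfamily set0 (mem (children f v)) F &, injective G}.
  move=> phi psi phiF psiF E; apply/ffunP => w.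
  have [wc|wc] := boolP (w \in children f v).
    by rewrite -(GK _ _ phiF wc) -(GK _ _ psiF wc) E.
  have out xi : xi \in pfamily set0 (mem (children f v)) F -> xi w = set0.
    by case/pfamilyP => /supportP H _; apply: H.
  by rewrite !out.
rewrite -(card_in_imset Ginj); apply: eq_card => S; apply/idP/imsetP.
  move=> SR; exists [ffun w => if w \in children f v then S :&: fringe f w else set0].
    apply/pfamilyP; split.
      by apply/supportP => w wc; rewrite ffunE (negPf wc).
    by move=> w wc; rewrite ffunE wc; exact: (rsub_cap SR wc).
  apply/setP => u; rewrite in_setU1.
  have Sfr := subsetP (rsub_fringe SR) u.
  apply/idP/orP => [uS|[/eqP->|/bigcupP[w wc]]]; last 2 first.
  - by case/rsubP: SR.
  - by rewrite ffunE wc inE => /andP[].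
  have := Sfr uS; rewrite fringeE in_setU1 => /orP[->|/bigcupP[w wc uw]]; first by left.
  by right; apply/bigcupP; exists w => //; rewrite ffunE wc inE uS.
case=> phi phiF ->; apply/rsubP; split=> [|u]; first by rewrite in_setU1 eqxx.
rewrite in_setU1 => /orP[/eqP->|]; first by rewrite eqxx.
case/bigcupP => w wc uw uv.
have := FP _ _ phiF wc; rewrite in_setU1 => /orP[/eqP p0|/rsubP[wp pP]].
  by rewrite p0 inE in uw.
have [->|nuw] := eqVneq u w.
  move: (wc); rewrite inE => /andP[wv /eqP->]; rewrite eq_sym wv.
  by rewrite in_setU1 eqxx.
have [-> H] := pP u uw nuw; split=> //.
by rewrite in_setU1; apply/orP; right; apply/bigcupP; exists w.
Qed.

Lemma rsub_gt0 v : 0 < #|rsub f v|.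
Proof. by rewrite card_rsub; apply: prodn_gt0. Qed.

(** In the product for the parent of [v], the factor belonging to [v] already exceeds
    [#|rsub f v|]. *)
Lemma rsub_le_root v : #|rsub f v| <= #|rsub f r|.
Proof.
move: v; apply: treefun_ind => // v vr IH; apply: leq_trans IH.
have vc : v \in children f (f v) by rewrite inE eqxx andbT eq_sym treefun_fix.
rewrite (card_rsub (f v)) (bigD1 v) //=; apply: leq_trans (leqnSn _) _.
by apply: leq_pmulr; apply: prodn_gt0.
Qed.

Lemma leq_sum_prod (I : finType) (P : pred I) (F G : I -> nat) :
  (forall i, P i -> F i <= G i) ->
  (\sum_(i | P i) F i).+1 <= \prod_(i | P i) (G i).+1.
Proof.
move=> FG; elim/big_rec2: _ => // i y x Pi; have := FG i Pi.
by move: (F i) (G i) => a b; nia.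
Qed.

Lemma card_fringe_rsub v : #|fringe f v| <= #|rsub f v|.
Proof.
move: {2}#|fringe f v| (leqnn #|fringe f v|) => m; elim: m v => [|m IH] v vm.
  by rewrite (leq_trans vm).
rewrite card_rsub card_fringe; apply: leq_sum_prod => w wc; apply: IH.
by rewrite -ltnS (leq_trans (card_fringe_child wc)).
Qed.

(** A leaf gives 0 on the left. Otherwise let one child have fringe size a and the remaining
    children total size A, both at least 1: the product is at least (a + 1)(A + 1), which is 2(a +
    A) + (a - 1)(A - 1). *)
Lemma card_fringe_rsub2 v : #|children f v| != 1 ->
  2 * #|fringe f v|.-1 <= #|rsub f v|.
Proof.
move=> c1; rewrite card_rsub card_fringe /=.
have [->|[w wc]] := set_0Vmem (children f v); first by rewrite !big_set0.
have [w' wc'] : exists w', w' \in children f v :\ w.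
  apply/set0Pn; apply: contra c1; rewrite setD_eq0 => sub.
  apply/cards1P; exists w; apply/eqP; rewrite eqEsubset sub.
  by apply/subsetP => x; rewrite inE => /eqP->.
rewrite (bigD1 w) //= [X in _ <= X](bigD1 w) //=.
set A := \sum_(i in _ | _) _; set P := \prod_(i in _ | _) _.
have AP : A < P by apply: leq_sum_prod => x _; exact: card_fringe_rsub.
have A1 : 0 < A.
  rewrite /A (bigD1 w') /=; last by move: wc'; rewrite !inE andbC.
  by rewrite ltn_addr //; apply/card_gt0P; exists w'; exact: fringe_id.
have w1 : 0 < #|fringe f w| by apply/card_gt0P; exists w; exact: fringe_id.
have := card_fringe_rsub w; move: #|fringe f w| #|rsub f w| w1 => a b.
by nia.
Qed.

(** Expanding every factor on the left over children, each vertex other than [r] occurs exactly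
    once, below its parent; the extra factor supplies [r]. *)
Lemma prod_rsub : \prod_v #|rsub f v| * #|rsub f r|.+1 = \prod_v #|rsub f v|.+1.
Proof.
rewrite [RHS](bigD1 r) //= mulnC; congr (_ * _).
under eq_bigr do rewrite card_rsub.
rewrite (exchange_big_dep (fun w => w != r)) /=; last first.
  move=> v w _; rewrite inE -treefun_fix => /andP[wv /eqP->].
  by rewrite eq_sym.
apply: eq_bigr => w wr; rewrite (big_pred1 (f w)) // => v /=.
rewrite inE; apply/andP/eqP => [[_ /eqP->] //|->].
by rewrite eq_sym treefun_fix.
Qed.

End Tree.
End Fringe.

(** * Edge sets of parent functions *)

Section Edges.
Variable V : finType.
Implicit Types (f : {ffun V -> V}) (S : {set V}) (r u v w x y : V) (E : {set {set V}}).

(** The root is left out because it is its own parent and would contribute a singleton. *)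
Definition edges r f : {set {set V}} := [set [set x; f x] | x in [set~ r]].

Lemma adj_sym E : symmetric (adj E).
Proof. by move=> x y; rewrite /adj setUC. Qed.

Section Tree.
Variables (r : V) (f : {ffun V -> V}).
Hypothesis fT : f \in treefun r.

Lemma adj_edges x y :
  adj (edges r f) x y = (x != r) && (f x == y) || (y != r) && (f y == x).
Proof.
have aux a b : a != r -> f a = b -> adj (edges r f) a b.
  by move=> ar <-; apply/imsetP; exists a; rewrite ?inE.
apply/idP/orP => [/imsetP[z]|[] /andP[xr /eqP fx]].
- rewrite !inE => zr E.
  have := in_set2 z x y; rewrite E set21 => /esym/orP[] /eqP ez; [left|right].
    rewrite -ez zr; have := in_set2 (f z) x y.
    by rewrite E set22 -ez (treefun_fix fT) (negPf zr) /= => <-.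
  rewrite -ez zr; have := in_set2 (f z) x y.
  by rewrite E set22 -ez (treefun_fix fT) (negPf zr) orbF => <-.
- exact: aux.
- by rewrite adj_sym; exact: aux.
Qed.

Lemma rsub_connected v S : S \in rsub f v -> connected_in (edges r f) S.
Proof.
move=> SR; have /rsubP[vS SP] := SR.
set e := (fun a b => [&& a \in S, b \in S & adj (edges r f) a b]).
have esym : connect_sym e.
  by apply: sym_connect_sym => a b; rewrite /e andbCA adj_sym.
have cv u : u \in S -> connect e u v.
  move=> uS; have uv := subsetP (rsub_fringe fT SR) u uS; move: u uv uS.
  apply: fringe_ind => [_|u uv IH uS]; first exact: connect0.
  have [fu fS] := SP u uS uv; apply: connect_trans (connect1 _) (IH fS).
  by rewrite /e uS fS adj_edges -(treefun_fix fT) fu eqxx.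
apply/forall_inP => x xS; apply/forall_inP => y yS.
by apply: connect_trans (cv x xS) _; rewrite esym; exact: cv.
Qed.

(** The only edge leaving the descendants of [u] goes from [u] to its parent, and a walk inside [S]
    starting at [u] cannot use it. *)
Lemma connected_fringe S u : connected_in (edges r f) S -> u \in S ->
  u = r \/ f u \notin S -> S \subset fringe f u.
Proof.
move=> /forall_inP Sc uS uP; apply/subsetP => y yS.
have /forall_inP/(_ y yS)/connectP[p] := Sc u uS.
have := fringe_id f u; move: {1 3 4}u => a; elim: p a => [|b p IH] a au /=.
  by move=> _ ->.
case/andP => /and3P[aS bS]; rewrite adj_edges => ab; apply: IH.
case/orP: ab => /andP[ar /eqP fa]; last first.
  by apply: fringe_trans au; rewrite -fa; exact: fringe_step.
rewrite -fa; apply: fringeS => //; apply/eqP => eau.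
by case: uP => [ur|]; [rewrite eau ur eqxx in ar|rewrite -eau fa bS].
Qed.

(** Climbing inside [S] until the parent falls outside gives a topmost vertex. A second such vertex
    would be a mutual descendant of the first, hence equal to it. *)
Lemma subtree_rsub S : subtree (edges r f) S -> exists v, S \in rsub f v.
Proof.
case/andP => /set0Pn[x xS] Sc.
have [v [vS vP]] : exists v, v \in S /\ (v = r \/ f v \notin S).
  move: x xS; apply: (treefun_ind fT) => [rS|x xr IH xS].
    by exists r; split=> //; left.
  have [/IH//|fxS] := boolP (f x \in S).
  by exists x; split=> //; right.
exists v; apply/rsubP; split=> // u uS uv.
have vu := subsetP (connected_fringe Sc vS vP) _ uS.
suff: ~ (u = r \/ f u \notin S).
  move=> H; rewrite (treefun_fix fT); split.
    by apply/eqP => ur; apply: H; left.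
  by apply/negPn/negP => fu; apply: H; right.
move=> uP; have uv' := subsetP (connected_fringe Sc uS uP) _ vS.
by rewrite (fringe_anti fT vu uv') eqxx in uv.
Qed.

Lemma num_subtrees_edges :
  num_subtrees (edges r f) <= #|V| * #|rsub f r|.
Proof.
apply: (@leq_trans (\sum_v #|rsub f v|)); last first.
  by rewrite -sum_nat_const; apply: leq_sum => v _; exact: rsub_le_root.
under [leqRHS]eq_bigr do rewrite -sum1_card.
rewrite (exchange_big_dep xpredT) //= /num_subtrees -sum1_card big_mkcond.
apply: leq_sum => S _; rewrite inE; case: ifP => // /subtree_rsub[v vS].
by rewrite (bigD1 v) //= leq_addr.
Qed.

Lemma num_rooted_subtrees_edges :
  num_rooted_subtrees (edges r f) r = #|rsub f r|.+1.
Proof.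
rewrite /num_rooted_subtrees addn1; congr _.+1; apply: eq_card => S.
rewrite inE; apply/andP/idP => [[St rS]|SR].
  have [v vR] := subtree_rsub St.
  have := subsetP (rsub_fringe fT vR) r rS => /(fringe_root fT) vr.
  by rewrite -vr.
have [rS _] := rsubP _ _ _ SR; rewrite rS /subtree (rsub_connected SR) andbT.
by split=> //; apply/set0Pn; exists r.
Qed.

Lemma setT_rsub : [set: V] \in rsub f r.
Proof.
by apply/rsubP; split=> [|u _ ur]; rewrite ?inE // (treefun_fix fT).
Qed.

(** Take a vertex of the cycle with the smallest fringe subtree. None of its children lies on the
    cycle, so both its neighbours there equal its parent, impossible with three distinct
    vertices. *)
Lemma edges_acyclic : acyclic (edges r f).
Proof.
move=> c /andP[cc uc]; rewrite leqNgt; apply/negP => c3.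
have [x xc] : exists x, x \in c.
  by case: c c3 {cc uc} => // x s _; exists x; rewrite mem_head.
have [v vc vmin] := @arg_minnP _ x (mem c) (fun v => #|fringe f v|) xc.
have nb y : y \in c -> adj (edges r f) v y -> y = f v.
  move=> yc; rewrite adj_edges => /orP[/andP[_ /eqP->]//|/andP[yr /eqP fy]].
  have : y \in children f v by rewrite inE fy eqxx andbT -fy eq_sym (treefun_fix fT).
  by move/(card_fringe_child fT); rewrite ltnNge vmin.
have nx : next c v = f v.
  by apply: nb; [rewrite mem_next|exact: next_cycle].
have pv : prev c v = f v.
  by apply: nb; [rewrite mem_prev|rewrite adj_sym; exact: prev_cycle].
have : next c (next c v) = v by rewrite nx -pv next_prev.
have [i p cE] := rot_to vc.
have up : uniq (v :: p) by rewrite -cE rot_uniq.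
rewrite -!(next_rot i uc) cE; move: c3; rewrite -(size_rot i) cE.
case: p up {cE} => [|a [|b p]] //=; rewrite !inE !negb_or eqxx.
move=> /and3P[/and3P[va vb _] _ _] _.
by rewrite (eq_sym a) (negPf va) eqxx => /eqP; rewrite eq_sym (negPf vb).
Qed.

Lemma edges_is_tree : is_tree (edges r f).
Proof.
split.
- move=> e /imsetP[x]; rewrite !inE => xr ->.
  by rewrite cards2 eq_sym (treefun_fix fT) xr.
- by apply/card_gt0P; exists r.
- exact: rsub_connected setT_rsub.
- exact: edges_acyclic.
Qed.

End Tree.

(** Induction away from the root: if [f] and [h] agree at [f x], the edge between [x] and [f x] must
    be directed alike in both, since otherwise [f (f x) = x]. *)
Lemma edges_inj r : {in treefun r &, injective (edges r)}.
Proof.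
move=> f h fT hT E; apply/ffunP; apply: (treefun_ind fT) => [|x xr IH].
  by rewrite !(treefun_root (r := r)).
have := adj_edges hT x (f x); rewrite -E adj_edges // xr eqxx /=.
move=> /esym/orP[/eqP-> //|/andP[fxr]]; rewrite -IH => /eqP ffx.
have := fringe_step f (f x); rewrite ffx => fxx.
by have := fringe_anti fT fxx (fringe_step f x) => /eqP; rewrite (treefun_fix fT) (negPf xr).
Qed.

(** The parent of a vertex is a neighbour closer to [r]. The resulting edges lie in [E] and already
    connect everything, so a further edge of [E] would close a cycle. *)
Lemma edges_surj r E : is_tree E -> exists2 f, f \in treefun r & edges r f = E.
Proof.
case=> Es _ Ec Ea.
pose d x m := [exists p : m.-tuple V, path (adj E) x p && (last x p == r)].
have dex x : exists m, d x m.
  have /forall_inP/(_ x (in_setT x))/forall_inP/(_ r (in_setT r)) := Ec.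
  case/connectP=> p pp pr; exists (size p); apply/existsP; exists (in_tuple p).
  rewrite -pr eqxx andbT /=; apply: sub_path pp => a b; by rewrite !in_setT.
pose dist x := ex_minn (dex x).
have step x : x != r -> exists y, adj E x y && (dist y < dist x).
  move=> xr; rewrite {2}/dist; case: ex_minnP => m /existsP[[p /= /eqP pm]].
  case: p pm => [|y p] pm /=; first by move=> /eqP e; rewrite e eqxx in xr.
  case/andP=> /andP[xy yp] lp _; exists y; rewrite xy -pm ltnS /dist.
  case: ex_minnP => k _; apply; apply/existsP; exists (in_tuple p).
  by rewrite yp.
pose f := [ffun x => if x == r then r else
                     odflt x [pick y | adj E x y && (dist y < dist x)]].
have fP x : x != r -> adj E x (f x) && (dist (f x) < dist x).
  move=> xr; rewrite ffunE (negPf xr); case: pickP => //= H.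
  by have [y] := step x xr; rewrite H.
have fT : f \in treefun r.
  apply/treefunP; split=> [|x]; first by rewrite ffunE eqxx.
  move: {2}(dist x) (leqnn (dist x)) => m; elim: m x => [|m IH] x xm;
    (have [->|xr] := eqVneq x r; first by apply: reaches0; rewrite inE);
    have /andP[_ lt] := fP x xr; first by have := leq_trans lt xm.
  by apply: reachesS; apply: IH; rewrite -ltnS (leq_trans lt).
exists f => //; apply/eqP; rewrite eqEsubset; apply/andP; split.
  by apply/subsetP => e /imsetP[x]; rewrite !inE => /fP/andP[? _] ->.
apply/subsetP => e eE; have /cards2P[x [y [xy exy]]] : #|e| == 2 by rewrite Es.
apply/negPn/negP => eN.
have := edges_is_tree fT => -[_ _ + _].
move=> /forall_inP/(_ x (in_setT x))/forall_inP/(_ y (in_setT y)).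
case/connectP=> p0 /shortenP[p pp up _] py.
have {}pp : path (adj (edges r f)) x p.
  by apply: sub_path pp => a b; rewrite !in_setT.
have ppE : path (adj E) x p.
  apply: sub_path pp => a b; rewrite adj_edges // => /orP[]/andP[/fP/andP[H _] /eqP <-] //.
  by rewrite adj_sym.
have cyc : ucycle (adj E) (x :: p).
  by apply/andP; split; rewrite //= rcons_path ppE -py adj_sym /adj -exy eE.
have := Ea _ cyc; case: p {ppE cyc up} pp py => [|a [|b p]] //=.
  by move=> _ exy'; rewrite exy' eqxx in xy.
by rewrite andbT => xa ya; case/negP: eN; rewrite exy ya.
Qed.

End Edges.

(** * Copies of a tree as a fringe subtree *)

Section Embeddings.
Variables (U V : finType).
Implicit Types (f : {ffun V -> V}) (t : {ffun U -> U}) (iota : {ffun U -> V}).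
Implicit Types (S Q : {set V}) (r v w x : V) (rho i : U).

Definition img iota : {set V} := iota @: [set: U].

Lemma mem_img iota i : iota i \in img iota.
Proof. by apply/imsetP; exists i; rewrite ?inE. Qed.

Lemma imgP iota x : reflect (exists i, x = iota i) (x \in img iota).
Proof.
by apply: (iffP imsetP) => [[i _ ->]|[i ->]]; exists i; rewrite ?inE.
Qed.

Lemma card_img iota : injective iota -> #|img iota| = #|U|.
Proof. by move=> inj; rewrite card_imset // cardsT. Qed.

Lemma card_setC_sub S : #|V| - #|S| = #|~: S|.
Proof. by rewrite [RHS]cardsCs setCK. Qed.

Lemma card_forest_compl S r : r \notin S ->
  (#|V| - #|S|) * #|forest [set r] (~: S :\ r)| = (#|V| - #|S|) ^ (#|V| - #|S|).-1.
Proof.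
move=> rS.
have dis : [disjoint [set r] & ~: S :\ r].
  by rewrite -setI_eq0; apply/eqP/setP => x; rewrite !inE; case: eqP.
have := card_forest dis; rewrite cards1 mul1n.
have -> : #|V| - #|S| = 1 + #|~: S :\ r|.
  by rewrite card_setC_sub (cardsD1 r) in_setC rS.
by [].
Qed.

(** The values of [f] on the image are free within [P], and the rest is a tree rooted at [r] on the
    complement. The last hypothesis says that every image vertex escapes to the complement, and
    hence reaches [r]. It is applied to one copy and to two disjoint copies at once. *)
Lemma card_fringe_glue iota r (P : U -> {set V}) : injective iota ->
  r \notin img iota ->
  (forall f, (forall i, f (iota i) \in P i) -> forall i, reaches f (~: img iota) (iota i)) ->
  #|[set f in treefun r | [forall i, f (iota i) \in P i] &&
       [forall x in ~: img iota, f x \notin img iota]]| =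
  (\prod_i #|P i|) * #|forest [set r] (~: img iota :\ r)|.
Proof.
move=> inj rS Pex; set S := img iota in rS Pex *; set D := ~: S :\ r.
(* [P] reindexed by the vertices of [V], as [card_glue] requires; injectivity makes this
   consistent. *)
pose P' x := [set y | [exists i, (iota i == x) && (y \in P i)]].
have P'E i : P' (iota i) = P i.
  apply/setP => y; rewrite inE; apply/existsP/idP => [[j /andP[/eqP/inj-> //]]|yP].
  by exists i; rewrite eqxx.
have -> : \prod_i #|P i| = \prod_(x in S) #|P' x|.
  rewrite /S /img big_imset /=; last by move=> ? ? _ _; exact: inj.
  by apply: eq_big => [i|i _]; rewrite ?inE // P'E.
have DE x : (x \in D) = (x != r) && (x \notin S) by rewrite !inE.
have dSD : [disjoint S & D].
  rewrite -setI_eq0; apply/eqP/setP => x; rewrite in_setI DE in_set0.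
  by case: (x \in S); rewrite ?andbF.
apply: (card_glue dSD) => [h /forestP[] //|f].
have rE x : x \in D -> restr D f x = f x by rewrite ffunE => ->.
have SDE x : (x \notin S :|: D) = (x == r).
  rewrite in_setU DE negb_or negb_and negbK; case: eqP => [->|_] /=.
    by rewrite rS.
  by rewrite negbK andNb.
rewrite inE; split.
  case/and3P => fT /forallP fP /forall_inP fS.
  split=> [x|x|].
  - by rewrite SDE => /eqP->; exact: treefun_root fT.
  - by case/imgP => i ->; rewrite P'E.
  apply/forestP; split=> [x xD|x|x].
  - by rewrite ffunE (negPf xD).
  - move=> xD; rewrite rE // in_setU in_set1 DE.
    case: eqP => //= _; apply: fS; move: xD; rewrite DE in_setC.
    by case/andP.
  rewrite DE => /andP[_]; move: x; apply: (treefun_ind fT) => [_|x xr IH xS].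
    by apply: reaches0; rewrite inE.
  apply: reachesS; rewrite rE ?DE ?xr //; apply: IH; apply: fS.
  by rewrite in_setC.
case=> f0 fP /forestP[_ h1 h2].
have fr : f r = r by apply: f0; rewrite SDE.
have fS x : x \notin S -> f x \notin S.
  move=> xS; have [->|xr] := eqVneq x r; first by rewrite fr.
  have xD : x \in D by rewrite DE xr.
  have := h1 x xD; rewrite rE // in_setU in_set1 DE.
  by case: eqP => [->|_ /=].
have fr1 x : x \notin S -> reaches f [set r] x.
  have [->|xr xS] := eqVneq x r; first by move=> _; apply: reaches0; rewrite inE.
  have xD : x \in D by rewrite DE xr.
  have := h2 x xD; move: xS {xr xD}; move=> /[swap]; move: x.
  apply: reaches_ind => [x|x IH xS]; first by move=> xr _; exact: reaches0.
  have [->|xr] := eqVneq x r; first by apply: reaches0; rewrite inE.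
  apply: reachesS; have xD : x \in D by rewrite DE xr.
  by rewrite -(rE x xD); apply: IH; rewrite rE // fS.
have fPi i : f (iota i) \in P i by rewrite -P'E; exact: fP (mem_img _ _).
apply/and3P; split.
- apply/treefunP; split=> // x.
  have [/imgP[i ->]|/fr1 //] := boolP (x \in S).
  have := Pex f fPi i; move: (iota i).
  apply: reaches_ind => [y|y]; first by rewrite in_setC; exact: fr1.
  exact: reachesS.
- exact/forallP.
- by apply/forall_inP => x; rewrite in_setC; exact: fS.
Qed.

(* [iota] is an isomorphism from the tree [t], rooted at [rho], onto a fringe subtree
   of [f] other than the whole tree. *)
Definition femb t rho f iota : bool :=
  [&& injectiveb iota, [forall i, (i != rho) ==> (f (iota i) == iota (t i))],
      f (iota rho) \notin img iota
    & [forall x in ~: img iota, f x \notin img iota]].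

Lemma fembP t rho f iota :
  reflect [/\ injective iota, forall i, i != rho -> f (iota i) = iota (t i),
              f (iota rho) \notin img iota
            & forall x, x \notin img iota -> f x \notin img iota]
          (femb t rho f iota).
Proof.
apply: (iffP and4P) => -[H1 H2 H3 H4]; split=> //.
- exact/injectiveP.
- by move=> i ir; have /forallP/(_ i) := H2; rewrite ir => /eqP.
- by move=> x xS; have /forall_inP/(_ x) := H4; rewrite in_setC; exact.
- exact/injectiveP.
- by apply/forallP => i; apply/implyP => ir; rewrite H2.
- by apply/forall_inP => x; rewrite in_setC; exact: H4.
Qed.

Section Fixed.
Variables (t : {ffun U -> U}) (rho : U).
Hypothesis tT : t \in treefun rho.

Section Emb.
Variables (r : V) (f : {ffun V -> V}) (iota : {ffun U -> V}).
Hypotheses (fT : f \in treefun r) (e : femb t rho f iota).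

Lemma femb_fringe : fringe f (iota rho) = img iota.
Proof.
case/fembP: e => inj et er ec; apply/setP => x; apply/idP/idP.
  move: x; apply: fringe_ind => [|u _]; first exact: mem_img.
  by apply: contraTT; exact: ec.
case/imgP => i ->; move: i; apply: (treefun_ind tT) => [|i ir IH].
  exact: fringe_id.
by apply: fringe_trans (fringe_step f _) _; rewrite et.
Qed.

(** The root is a fixed point of [f]. Inside the image it would keep the top of the copy from
    leaving the image, or make some vertex other than [rho] a fixed point of [t]. *)
Lemma femb_root : r \notin img iota.
Proof.
case/fembP: e => inj et er ec; apply/negP => /imgP[i ri].
have [ir|ir] := eqVneq i rho.
  by have := er; rewrite -ir -ri (treefun_root fT) ri mem_img.
have := et i ir; rewrite -ri (treefun_root fT) ri => /inj/esym/eqP.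
by rewrite (treefun_fix tT) (negPf ir).
Qed.

Lemma femb_children : children f (iota rho) = iota @: children t rho.
Proof.
case/fembP: e => inj et er ec; apply/setP => w; apply/idP/imsetP.
  rewrite inE => /andP[wr /eqP fw].
  have /imgP[i wi] : w \in img iota.
    by apply/negPn/negP => /ec; rewrite fw mem_img.
  exists i => //; rewrite wi (inj_eq inj) in wr.
  by rewrite inE wr; apply/eqP/inj; rewrite -et // -wi.
case=> i; rewrite inE => /andP[ir /eqP ti] ->.
by rewrite inE (inj_eq inj) ir et // ti eqxx.
Qed.

Lemma card_femb_children : #|children f (iota rho)| = #|children t rho|.
Proof. by rewrite femb_children card_imset //; case/fembP: e. Qed.

Lemma card_femb_fringe : #|fringe f (iota rho)| = #|U|.
Proof. by rewrite femb_fringe card_img //; case/fembP: e. Qed.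

Lemma card_femb_rsub : #|rsub f (iota rho)| = #|rsub t rho|.
Proof.
case/fembP: e => inj et er ec.
rewrite -(card_imset _ (imset_inj inj)); apply: eq_card => S; apply/idP/imsetP.
  move=> SR; have SI := rsub_fringe fT SR; rewrite femb_fringe in SI.
  have SE : S = [set iota x | x in iota @^-1: S].
    apply/setP => x; apply/idP/imsetP => [xS|[i]]; last by rewrite inE => ? ->.
    have /imgP[i xi] := subsetP SI x xS.
    by exists i; rewrite // inE -xi.
  exists (iota @^-1: S) => //; apply/rsubP.
  case/rsubP: SR => vS SP; split=> [|i]; first by rewrite inE.
  rewrite !inE => iS ir; have := SP _ iS; rewrite (inj_eq inj) => /(_ ir).
  by rewrite et // (inj_eq inj).
case=> A /rsubP[rA AP] ->; apply/rsubP; split; first exact: imset_f.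
move=> _ /imsetP[i iA ->]; rewrite (inj_eq inj) => ir.
have [ti tA] := AP i iA ir; rewrite et // (inj_eq inj).
by split=> //; exact: imset_f.
Qed.

End Emb.

(** Every image vertex has a forced parent except the top one, which chooses in [Q]. The cases of
    interest are [Q] the whole complement of the image and [Q] the root alone. *)
Lemma card_femb r iota Q : injective iota -> r \notin img iota ->
  [disjoint Q & img iota] ->
  #|[set f in treefun r | femb t rho f iota && (f (iota rho) \in Q)]| =
  #|Q| * #|forest [set r] (~: img iota :\ r)|.
Proof.
move=> inj rS dQ; pose P i := if i == rho then Q else [set iota (t i)].
have -> : #|Q| = \prod_i #|P i|.
  rewrite (bigD1 rho) //= {1}/P eqxx big1 ?muln1 // => i ir.
  by rewrite /P (negPf ir) cards1.
rewrite -card_fringe_glue //; last first.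
  move=> f fP; apply: (treefun_ind tT) => [|i ir IH].
    have := fP rho; rewrite /P eqxx => fQ; apply: reachesS; apply: reaches0.
    by rewrite in_setC (disjointFr dQ).
  apply: reachesS; have := fP i; rewrite /P (negPf ir) inE => /eqP->.
  exact: IH.
apply: eq_card => f; rewrite [LHS]inE [RHS]inE; apply: andb_id2l => fT.
apply/idP/idP.
  case/andP=> /fembP[_ et er ec] fQ; apply/andP; split.
    apply/forallP => i; rewrite /P; case: eqP => [-> //|/eqP ir].
    by rewrite et // inE.
  by apply/forall_inP => x; rewrite in_setC; exact: ec.
case/andP=> /forallP fP /forall_inP fS.
have fQ : f (iota rho) \in Q by have := fP rho; rewrite /P eqxx.
rewrite fQ andbT; apply/fembP; split=> //.
- by move=> i ir; have := fP i; rewrite /P (negPf ir) inE => /eqP.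
- by rewrite (disjointFr dQ).
- by move=> x xS; apply: fS; rewrite in_setC.
Qed.

Definition nemb f := #|[set iota | femb t rho f iota]|.

Lemma card_injective_avoiding (S : {set V}) :
  #|[set iota : {ffun U -> V} | injectiveb iota & [disjoint img iota & S]]| =
  #|~: S| ^_ #|U|.
Proof.
rewrite -(card_inj_ffuns_on U (mem (~: S))); apply: eq_card => iota; rewrite !inE andbC.
congr (_ && _); apply/idP/ffun_onP => [dS i|iS].
  by rewrite !inE (disjointFr dS) // mem_img.
rewrite -setI_eq0; apply/eqP/setP => x; rewrite in_set0 in_setI.
by apply/negP => /andP[/imgP[i ->]]; apply/negP; have := iS i; rewrite !inE.
Qed.

(** Summing over [iota] instead: it must avoid [r], and an admissible one leaves n - k parents for
    its top and a tree on n - k vertices with given root, in all (n - k)^(n - k - 1) parent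
    functions. *)
Lemma sum_nemb r : \sum_(f in treefun r) nemb f =
  #|V|.-1 ^_ #|U| * (#|V| - #|U|) ^ (#|V| - #|U|).-1.
Proof.
have -> : #|V|.-1 = #|~: [set r]| by rewrite cardsC1.
rewrite -card_injective_avoiding -sum_nat_const.
have -> : \sum_(f in treefun r) nemb f =
   \sum_(iota : {ffun U -> V}) \sum_(f in treefun r | femb t rho f iota) 1.
  rewrite (exchange_big_dep (mem (treefun r))) /=; last by move=> ? ? _ /andP[].
  apply: eq_bigr => f fT; rewrite /nemb -sum1_card; apply: eq_bigl => iota.
  by rewrite inE fT.
rewrite [RHS]big_mkcond /=; apply: eq_bigr => iota _.
rewrite inE; case: ifPn => [/andP[/injectiveP inj dr]|nI].
  have rS : r \notin img iota by rewrite (disjointFl dr) // inE.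
  rewrite -(card_img inj) -(card_forest_compl rS) card_setC_sub.
  rewrite -card_femb // ?disjoints_subset ?subxx // -sum1_card.
  apply: eq_bigl => f; rewrite inE; congr (_ && _).
  apply/idP/andP => [e|[]] //; split=> //.
  by rewrite in_setC; case/fembP: e.
apply: big1 => f /andP[fT e]; case/negP: nI.
have rS := femb_root fT e; case/fembP: e => /injectiveP-> _ _ _.
by rewrite disjoint_sym disjoints1.
Qed.

(** Here the copy hangs directly below the root. Its parent is forced, but the root ranges over the
    n - k vertices outside the image, which restores the same factor. This count drives the
    recursion of [sum_shapes_rsub]. *)
Lemma sum_nemb_at_root : #|U| < #|V| ->
  \sum_r \sum_(f in treefun r) #|[set iota | femb t rho f iota & f (iota rho) == r]| =
  #|V| ^_ #|U| * (#|V| - #|U|) ^ (#|V| - #|U|).-1.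
Proof.
move=> UV.
have := card_injective_avoiding set0; rewrite setC0 cardsT => <-.
rewrite -sum_nat_const.
have -> : \sum_r \sum_(f in treefun r) #|[set iota | femb t rho f iota & f (iota rho) == r]| =
   \sum_(iota : {ffun U -> V}) \sum_r
     #|[set f in treefun r | femb t rho f iota && (f (iota rho) \in [set r])]|.
  rewrite [RHS]exchange_big; apply: eq_bigr => r _ /=.
  under [RHS]eq_bigr do rewrite -sum1_card.
  rewrite (exchange_big_dep (mem (treefun r))) /=; last first.
    by move=> ? f _; rewrite inE => /andP[].
  apply: eq_bigr => f fT; rewrite -sum1_card; apply: eq_bigl => iota.
  by rewrite !in_set fT in_set1.
rewrite [RHS]big_mkcond /=; apply: eq_bigr => iota _.
rewrite inE; case: ifPn => [/andP[/injectiveP inj _]|nI]; last first.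
  apply: big1 => r _; apply: eq_card0 => f; rewrite inE; apply/negP => /and3P[_ e _].
  case/negP: nI; case/fembP: e => /injectiveP-> _ _ _.
  by rewrite -setI_eq0 setI0 eqxx.
rewrite -(card_img inj).
have [r0 r0S] : exists r0, r0 \notin img iota.
  have /card_gt0P[x] : 0 < #|~: img iota| by rewrite cardsCs setCK card_img // subn_gt0.
  by rewrite in_setC; exists x.
transitivity (\sum_(r in ~: img iota) #|forest [set r0] (~: img iota :\ r0)|); last first.
  by rewrite sum_nat_const -(card_forest_compl r0S) card_setC_sub.
rewrite [RHS]big_mkcond /=; apply: eq_bigr => r _; rewrite in_setC.
case: ifPn => rS.
  rewrite card_femb // ?cards1 ?mul1n; last by rewrite disjoints_subset sub1set in_setC.
  have pos : 0 < #|V| - #|img iota| by rewrite card_img // subn_gt0.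
  by apply/eqP; rewrite -(eqn_pmul2l pos) !card_forest_compl.
apply: eq_card0 => f; rewrite inE; apply/negP => /and3P[fT e _].
by have := femb_root fT e; rewrite (negPf rS).
Qed.

End Fixed.

(** Fringe subtrees that meet are nested, and these have the same size. *)
Lemma femb_meet t rho r f iota1 iota2 x : t \in treefun rho -> f \in treefun r ->
  femb t rho f iota1 -> femb t rho f iota2 ->
  x \in img iota1 -> x \in img iota2 -> img iota1 = img iota2.
Proof.
move=> tT fT; wlog le : iota1 iota2 / iota1 rho \in fringe f (iota2 rho).
  move=> H e1 e2 x1 x2.
  have x1' : x \in fringe f (iota1 rho) by rewrite (femb_fringe tT e1).
  have x2' : x \in fringe f (iota2 rho) by rewrite (femb_fringe tT e2).
  case/orP: (fringe_total x1' x2') => le; first exact: (H _ _ le e1 e2 x1 x2).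
  exact/esym/(H _ _ le e2 e1 x2 x1).
move=> e1 e2 _ _; apply/eqP; rewrite eqEcard.
have [inj1 _ _ _] := fembP _ _ _ _ e1; have [inj2 _ _ _] := fembP _ _ _ _ e2.
rewrite !card_img // leqnn andbT -(femb_fringe tT e1) -(femb_fringe tT e2).
by apply/subsetP => y ye; exact: fringe_trans ye le.
Qed.

End Embeddings.

(** * Second moment of the number of copies *)

Section SecondMoment.
Variables (U V : finType).
Implicit Types (f : {ffun V -> V}) (t : {ffun U -> U}) (iota : {ffun U -> V}).

(** Two disjoint copies form one embedding of [U + U], to which [card_fringe_glue] applies: (n -
    2k)^2 choices for the two parents and (n - 2k)^(n - 2k - 2) trees on the rest. *)
Lemma card_femb_pair t rho r (iota1 iota2 : {ffun U -> V}) : t \in treefun rho ->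
  [disjoint img iota1 & img iota2] -> 2 * #|U| < #|V| ->
  #|[set f in treefun r | femb t rho f iota1 && femb t rho f iota2]| <=
  (#|V| - 2 * #|U|) ^ (#|V| - 2 * #|U|).
Proof.
move=> tT dj UV.
set X := [set f in _ | _].
have [->|[f0]] := set_0Vmem X; first by rewrite cards0.
rewrite inE => /and3P[f0T e01 e02].
have r1 := femb_root tT f0T e01; have r2 := femb_root tT f0T e02.
have [inj1 _ _ _] := fembP _ _ _ _ e01; have [inj2 _ _ _] := fembP _ _ _ _ e02.
pose iota : {ffun U + U -> V} :=
  [ffun s => match s with inl i => iota1 i | inr i => iota2 i end].
have imgE x : (x \in img iota) = (x \in img iota1) || (x \in img iota2).
  apply/imgP/orP => [[[i|i]]|[/imgP[i ->]|/imgP[i ->]]]; rewrite ?ffunE.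
  - by move=> ->; left; exact: mem_img.
  - by move=> ->; right; exact: mem_img.
  - by exists (inl i); rewrite ffunE.
  - by exists (inr i); rewrite ffunE.
have inj : injective iota.
  move=> [i|i] [j|j]; rewrite !ffunE.
  - by move/inj1->.
  - by move=> E; have := disjointFr dj (mem_img iota1 i); rewrite E mem_img.
  - by move=> E; have := disjointFr dj (mem_img iota1 j); rewrite -E mem_img.
  - by move/inj2->.
have rS : r \notin img iota by rewrite imgE negb_or r1.
(* The top of either copy has its parent outside both images: outside its own by definition, and
   outside the other because no edge enters that image from without. *)
pose P (s : U + U) : {set V} := match s with
  | inl i => if i == rho then ~: img iota else [set iota1 (t i)]
  | inr i => if i == rho then ~: img iota else [set iota2 (t i)] end.
have cU : #|{: U + U}| = 2 * #|U| by rewrite card_sum mul2n addnn.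
have cP : \prod_s #|P s| = (#|V| - 2 * #|U|) * (#|V| - 2 * #|U|).
  rewrite big_sumType /= -cU -(card_img inj) card_setC_sub.
  by congr (_ * _); rewrite (bigD1 rho) //= eqxx big1 ?muln1 // => i /negPf->;
    rewrite cards1.
have Pex f : (forall s, f (iota s) \in P s) ->
    forall s, reaches f (~: img iota) (iota s).
  move=> fP [] i; move: i; apply: (treefun_ind tT) => [|i ir IH]; apply: reachesS.
  - by apply: reaches0; have := fP (inl rho); rewrite /= eqxx.
  - have := fP (inl i); rewrite /= (negPf ir) inE => /eqP->.
    by move: IH; rewrite ffunE.
  - by apply: reaches0; have := fP (inr rho); rewrite /= eqxx.
  - have := fP (inr i); rewrite /= (negPf ir) inE => /eqP->.
    by move: IH; rewrite ffunE.
have := card_fringe_glue inj rS Pex; rewrite cP.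
have := card_forest_compl rS; rewrite card_img // cU => cF.
rewrite -mulnA cF -expnS prednK ?subn_gt0 // => <-.
apply: subset_leq_card; apply/subsetP => f; rewrite !in_set.
case/and3P=> fT e1 e2; rewrite fT /=.
have [_ et1 er1 ec1] := fembP _ _ _ _ e1; have [_ et2 er2 ec2] := fembP _ _ _ _ e2.
apply/andP; split.
  apply/forallP => -[i|i]; rewrite ffunE /=; case: eqP => [->|/eqP ir].
  - rewrite in_setC imgE negb_or er1 ec2 // (disjointFr dj) // mem_img //.
  - by rewrite et1 // inE.
  - rewrite in_setC imgE negb_or er2 ec1 // (disjointFl dj) // mem_img //.
  - by rewrite et2 // inE.
apply/forall_inP => x; rewrite in_setC !imgE !negb_or => /andP[x1 x2].
by rewrite ec1 // ec2.
Qed.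

(** Pairs of embeddings are split by whether the images are disjoint. If they meet they coincide, so
    the second embedding is one of at most k^k maps into the first image; these pairs contribute
    only a first moment. *)
Lemma nemb_sqr_le t rho (r : V) : t \in treefun rho -> 2 * #|U| < #|V| ->
  \sum_(f in treefun r) nemb t rho f ^ 2 <=
  #|V| ^ (2 * #|U|) * (#|V| - 2 * #|U|) ^ (#|V| - 2 * #|U|)
  + #|U| ^ #|U| * \sum_(f in treefun r) nemb t rho f.
Proof.
move=> tT UV.
pose dj (p : {ffun U -> V} * {ffun U -> V}) := [disjoint img p.1 & img p.2].
pose X f := [set p : {ffun U -> V} * {ffun U -> V} |
               [&& femb t rho f p.1, femb t rho f p.2 & dj p]].
have sq f : f \in treefun r -> nemb t rho f ^ 2 <= #|X f| + #|U| ^ #|U| * nemb t rho f.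
  move=> fT; rewrite -mulnn /nemb -cardsX.
  rewrite -(cardsID (X f)) leq_add //.
    by apply: subset_leq_card; exact: subsetIr.
  rewrite mulnC -sum_nat_const -sum1_card.
  rewrite (partition_big fst (mem [set iota | femb t rho f iota])) /=; last first.
    by move=> [p q]; rewrite in_setD in_setX => /and3P[].
  apply: leq_sum => iota; rewrite inE => ei; rewrite sum1dep_card.
  have -> : #|U| ^ #|U| = #|(ffun_on (img iota) : {pred {ffun U -> V}})|.
    by rewrite card_ffun_on card_img //; case/fembP: ei.
  rewrite -(card_in_imset (f := snd)); last first.
    move=> [i1 i2] [j1 j2]; rewrite !in_set /= => /andP[_ /eqP->] /andP[_ /eqP->].
    by move=> ->.
  apply: subset_leq_card; apply/subsetP => _ /imsetP[[i1 i2] + ->] /=.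
  rewrite !in_set /= => /andP[/andP[nX /andP[e1 e2]] /eqP i1E].
  move: nX; rewrite e1 e2 /= /dj -setI_eq0 /= => /set0Pn[x].
  rewrite inE => /andP[x1 x2]; apply/ffun_onP => i.
  by rewrite -i1E (femb_meet tT fT e1 e2 x1 x2) mem_img.
apply: (@leq_trans (\sum_(f in treefun r) (#|X f| + #|U| ^ #|U| * nemb t rho f))).
  exact: leq_sum.
rewrite big_split /= -big_distrr /= leq_add2r.
have -> : \sum_(f in treefun r) #|X f| = \sum_(p | dj p)
    #|[set f in treefun r | femb t rho f p.1 && femb t rho f p.2]|.
  under eq_bigr do rewrite -sum1_card.
  rewrite (exchange_big_dep dj) /=; last by move=> f p _; rewrite inE => /and3P[].
  apply: eq_bigr => p pd; rewrite -sum1_card; apply: eq_bigl => f.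
  by rewrite !in_set pd andbT.
apply: (@leq_trans (\sum_(p | dj p) (#|V| - 2 * #|U|) ^ (#|V| - 2 * #|U|))).
  by apply: leq_sum => p pd; exact: card_femb_pair.
rewrite sum_nat_cond_const leq_mul2r; apply/orP; right.
apply: leq_trans (max_card _) _.
by rewrite card_prod !card_ffun mul2n -addnn expnD.
Qed.

End SecondMoment.

(** * Vertices sorted by the shape of their fringe subtree *)

Section Occurrences.
Variables (U V : finType).
Local Open Scope ring_scope.

(* Every bijection from [U] onto the fringe subtree of [v] determines the labelled
   tree of which it is an embedding, whence the factor [#|U|`!]. *)
Lemma sum_femb (M : nmodType) (r : V) (f : {ffun V -> V}) (phi : V -> M) :
  f \in treefun r ->
  \sum_(rho : U) \sum_(t in treefun rho) \sum_(iota | femb t rho f iota) phi (iota rho) =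
  (\sum_(v | (v != r) && (#|fringe f v| == #|U|)%N) phi v) *+ (#|U|)`!.
Proof.
move=> fT.
pose T := (U * {ffun U -> U} * {ffun U -> V})%type.
pose C (p : T) := (p.1.2 \in treefun p.1.1) && femb p.1.2 p.1.1 f p.2.
have -> : \sum_(rho : U) \sum_(t in treefun rho)
    \sum_(iota | femb t rho f iota) phi (iota rho) =
    \sum_(p : T | C p) phi (p.2 p.1.1).
  by rewrite pair_big_dep /= pair_big_dep.
rewrite (partition_big (fun p : T => p.2 p.1.1)
  (fun v => (v != r) && (#|fringe f v| == #|U|)%N)) /=; last first.
  move=> [[rho t] iota] /andP[/= tT e]; rewrite (card_femb_fringe tT e) eqxx andbT.
  by apply: contraNneq (femb_root tT fT e) => <-; exact: mem_img.
rewrite -sumrMnl; apply: eq_bigr => v /andP[vr /eqP cv].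
rewrite (eq_bigr (fun _ => phi v)); last by move=> p /andP[_ /eqP->].
rewrite sumr_const; congr (_ *+ _).
pose J := [set iota : {ffun U -> V} in ffun_on (mem (fringe f v)) | injectiveb iota].
have <- : #|J| = (#|U|)`! by rewrite card_inj_ffuns_on cv ffactnn.
pose X := [set p : T | C p & p.2 p.1.1 == v].
have -> : #|(fun p : T => C p && (p.2 p.1.1 == v))| = #|X|.
  by apply: eq_card => p; rewrite !inE.
(* [iota] determines the rest: [rho] is the preimage of [v], and [t] is [f] pulled back along
   [iota]. *)
rewrite -(card_in_imset (f := snd) (D := mem X)); last first.
  move=> [[rho t] iota] [[rho' t'] iota']; rewrite !in_set /C /=.
  move=> /andP[/andP[tT e] /eqP vE] /andP[/andP[tT' e'] /eqP vE'] ii; subst iota'.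
  have [inj et _ _] := fembP _ _ _ _ e; have [_ et' _ _] := fembP _ _ _ _ e'.
  have rr : rho' = rho by apply: inj; rewrite vE.
  subst rho'; congr (_, _, _); apply/ffunP => i; have [->|ir] := eqVneq i rho.
    by rewrite (treefun_root tT) (treefun_root tT').
  by apply: inj; rewrite -et // -et'.
apply: eq_card => iota; apply/imsetP/idP.
  case=> -[[rho t] iota']; rewrite !in_set /C /= => /andP[/andP[tT e] /eqP vE] ->.
  have [inj _ _ _] := fembP _ _ _ _ e; apply/andP; split; last exact/injectiveP.
  by apply/ffun_onP => i; rewrite -vE (femb_fringe tT e) mem_img.
rewrite inE => /andP[/ffun_onP ion /injectiveP inj].
have iE : img iota = fringe f v.
  apply/eqP; rewrite eqEcard card_img // cv leqnn andbT.
  by apply/subsetP => x /imgP[i ->]; exact: ion.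
have [rho vE] : exists i, v = iota i by apply/imgP; rewrite iE fringe_id.
(* The pullback of [f]. The default is never reached, since below [v] the parent of an image vertex
   stays in the image. *)
pose t := [ffun i => if i == rho then rho else odflt i [pick j | iota j == f (iota i)]].
have tE i : i != rho -> f (iota i) = iota (t i).
  move=> ir; rewrite ffunE (negPf ir).
  have /imgP[j fj] : f (iota i) \in img iota.
    rewrite iE; apply: fringeS; first by rewrite -iE mem_img.
    by rewrite vE (inj_eq inj).
  by case: pickP => [j' /eqP //|/(_ j)]; rewrite fj eqxx.
have tr : t rho = rho by rewrite ffunE eqxx.
have tT : t \in treefun rho.
  apply/treefunP; split=> // i.
  have : iota i \in fringe f v by rewrite -iE mem_img.
  move: {2 3}(iota i) (erefl (iota i)) => x + xv; move: x xv i.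
  apply: fringe_ind => [i|x xv IH i xi].
    by rewrite vE => /inj->; apply: reaches0; rewrite inE.
  have ir : i != rho by move: xv; rewrite -xi vE (inj_eq inj).
  by apply: reachesS; apply: IH; rewrite -tE // xi.
exists (rho, t, iota) => //; rewrite !in_set /C /= tT -vE eqxx andbT /=.
apply/fembP; split=> //; rewrite iE.
  rewrite -vE; apply/negP => /(fringe_anti fT (fringe_step f v))/esym/eqP.
  by rewrite (treefun_fix fT) (negPf vr).
by move=> x; apply: contra => fx; apply: fringe_trans (fringe_step f x) fx.
Qed.

End Occurrences.

(** * Numbers of rooted trees, in total and with a root of degree one *)

Section Shapes.
Variable U : finType.

Lemma card_rooted_treefun : 0 < #|U| ->
  \sum_(rho : U) #|treefun rho| = #|U| ^ #|U|.-1.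
Proof.
move=> U0; apply/eqP; rewrite -(eqn_pmul2l U0) big_distrr /=; apply/eqP.
by under eq_bigr do rewrite card_treefun; rewrite sum_nat_const.
Qed.

(** Deleting a root with single child [w] leaves a tree rooted at [w]: (k - 1)^(k - 3) trees, for
    each of k - 1 children and k roots. This is the count in the exponent of [xi2]. *)
Lemma card_rooted_treefun1 : 1 < #|U| ->
  \sum_(rho : U) #|[set t in treefun rho | #|children t rho| == 1]| =
  #|U| * #|U|.-1 ^ (#|U| - 2).
Proof.
move=> U1; have U0 : 0 < #|U|.-1 by lia.
rewrite -sum_nat_const; apply: eq_bigr => rho _.
have dis : [disjoint [set rho] & [set~ rho]].
  by rewrite disjoints1 !inE eqxx.
have chE (t : {ffun U -> U}) : [set x in [set~ rho] | t x \in [set rho]] = children t rho.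
  by apply/setP => x; rewrite !inE.
have lev w : w != rho ->
    #|U|.-1 * #|[set t in treefun rho | children t rho == [set w]]| = #|U|.-1 ^ (#|U| - 2).
  move=> wr; have sw : [set w] \subset [set~ rho] by rewrite sub1set !inE.
  have -> : #|[set t in treefun rho | children t rho == [set w]]| =
      #|forest [set w] ([set~ rho] :\: [set w])|.
    have := card_forest_level dis sw; rewrite !cards1 exp1n mul1n => <-.
    by apply: eq_card => t; rewrite !in_set chE.
  have dw : [disjoint [set w] & [set~ rho] :\: [set w]].
    by rewrite disjoints1 !inE eqxx.
  have := card_forest dw; rewrite !cards1 mul1n cardsD (setIidPr sw) cards1 cardsC1.
  rewrite add1n subn1 prednK // => ->; congr (_ ^ _).
  by rewrite -!subn1 -subnDA.
apply/eqP; rewrite -(eqn_pmul2l U0); apply/eqP.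
have -> : #|[set t in treefun rho | #|children t rho| == 1]| =
    \sum_(w | w != rho) #|[set t in treefun rho | children t rho == [set w]]|.
  under [RHS]eq_bigr do rewrite -sum1_card.
  rewrite (exchange_big_dep (mem [set t in treefun rho | #|children t rho| == 1])) /=.
    rewrite -sum1_card; apply: eq_bigr => t; rewrite inE => /andP[tT /cards1P[w cw]].
    rewrite (big_pred1 w) // => w' /=; rewrite in_set tT cw /=.
    have := set11 w; rewrite -cw inE => /andP[wr _].
    apply/andP/eqP => [[_ /eqP E]|->]; last by rewrite cw eqxx.
    by apply: set1_inj; rewrite -E cw.
  by move=> w t _; rewrite !in_set => /andP[-> /eqP->]; rewrite cards1.
rewrite big_distrr /= (eq_bigr _ lev) sum_nat_cond_const; congr (_ * _).
rewrite -(cardsC1 rho); apply: eq_card => x; rewrite !inE.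
by [].
Qed.

End Shapes.

(** * Limits *)

Local Open Scope ring_scope.

Section Limits.
Local Open Scope classical_set_scope.
Local Open Scope ring_scope.
Variable R : realType.
Implicit Types (m k j n : nat).

Lemma cvg_invn : (fun n => (n%:R : R)^-1) @ \oo --> (0 : R).
Proof. by rewrite -cvg_shiftS; exact: cvg_harmonic. Qed.

Lemma cvg_subn_ratio m : (fun n => (n - m)%:R / n%:R : R) @ \oo --> (1 : R).
Proof.
have : (fun n => 1 - m%:R * (n%:R : R)^-1) @ \oo --> (1 - m%:R * 0 : R).
  by apply: cvgB; [exact: cvg_cst|apply: cvgM; [exact: cvg_cst|exact: cvg_invn]].
rewrite mulr0 subr0; apply: cvg_trans; apply: near_eq_cvg; near=> n.
have mn : (m < n)%N by near: n; exact: nbhs_infty_gt.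
rewrite natrB; last exact: ltnW.
by rewrite mulrBl divff // pnatr_eq0 -lt0n (leq_ltn_trans _ mn).
Unshelve. all: by end_near. Qed.

(** Both bounds are 1 + x <= exp x: with x = -m/n from above, and with x = m/(n - m), where 1 + x =
    n/(n - m), from below. *)
Lemma cvg_subn_ratio_exp m :
  (fun n => ((n - m)%:R / n%:R : R) ^+ n) @ \oo --> (expR (- m%:R) : R).
Proof.
have lo : (fun n => expR (- m%:R * ((n - m)%:R / n%:R : R)^-1)) @ \oo
    --> (expR (- m%:R) : R).
  have : (fun n => - m%:R * ((n - m)%:R / n%:R : R)^-1) @ \oo --> (- m%:R * 1^-1 : R).
    apply: cvgM; first exact: cvg_cst.
    by apply: cvgV; [exact: oner_neq0|exact: cvg_subn_ratio].
  rewrite invr1 mulr1 => H; exact: (cvg_comp _ _ H (@continuous_expR R _)).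
apply: (squeeze_cvgr _ lo (cvg_cst _)); near=> n.
have mn : (m < n)%N by near: n; exact: nbhs_infty_gt.
have n0 : (0 : R) < n%:R by rewrite ltr0n (leq_ltn_trans _ mn).
have nm0 : (0 : R) < (n - m)%:R by rewrite ltr0n subn_gt0.
have q0 : (0 : R) < (n - m)%:R / n%:R by rewrite divr_gt0.
have qE : (n - m)%:R = n%:R - m%:R :> R by rewrite natrB // ltnW.
apply/andP; split.
  have -> : - m%:R * ((n - m)%:R / n%:R)^-1 = n%:R * (- (m%:R / (n - m)%:R)) :> R.
    by rewrite invf_div; field; apply: lt0r_neq0.
  rewrite expRM_natl lerXn2r ?nnegrE ?expR_ge0 ?(ltW q0) //.
  rewrite expRN -[leRHS]invrK lef_pV2 ?posrE ?expR_gt0 ?invr_gt0 //.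
  apply: le_trans (expR_ge1Dx _); rewrite invf_div le_eqVlt; apply/orP; left.
  apply/eqP; rewrite -{1}(subrK m%:R (n%:R : R)) -qE.
  by rewrite mulrDl divff ?lt0r_neq0.
have -> : - m%:R = n%:R * (- (m%:R / n%:R)) :> R by field; apply: lt0r_neq0.
rewrite expRM_natl lerXn2r ?nnegrE ?expR_ge0 ?(ltW q0) //.
apply: le_trans (expR_ge1Dx _).
by rewrite qE mulrBl divff ?lt0r_neq0.
Unshelve. all: by end_near. Qed.

Lemma cvg_exprn (u : nat -> R) (a : R) j : u @ \oo --> a ->
  (fun n => u n ^+ j) @ \oo --> a ^+ j.
Proof.
move=> ua; elim: j => [|j IH].
  by rewrite expr0; under eq_fun do rewrite expr0; exact: cvg_cst.
rewrite exprS; under eq_fun do rewrite exprS; exact: cvgM.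
Qed.

Lemma cvg_subn_ratio_expB m j :
  (fun n => ((n - m)%:R / n%:R : R) ^+ (n - j)) @ \oo --> (expR (- m%:R) : R).
Proof.
have : (fun n => ((n - m)%:R / n%:R : R) ^+ n / ((n - m)%:R / n%:R) ^+ j) @ \oo
    --> (expR (- m%:R) / 1 ^+ j : R).
  apply: cvgM; first exact: cvg_subn_ratio_exp.
  apply: cvgV; first by rewrite expr1n oner_neq0.
  by apply: cvg_exprn; exact: cvg_subn_ratio.
rewrite expr1n divr1; apply: cvg_trans; apply: near_eq_cvg; near=> n.
have mn : (m < n)%N by near: n; exact: nbhs_infty_gt.
have jn : (j < n)%N by near: n; exact: nbhs_infty_gt.
have q0 : ((n - m)%:R / n%:R : R) != 0.
  by rewrite mulf_neq0 ?invr_eq0 // pnatr_eq0 -lt0n ?subn_gt0 // (leq_ltn_trans _ mn).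
move: q0; set q := _ / _ => q0.
have -> : q ^+ n = q ^+ (n - j) * q ^+ j by rewrite -exprD subnK // ltnW.
by rewrite mulfK // expf_neq0.
Unshelve. all: by end_near. Qed.

Lemma cvg_ffact_ratio k : (fun n => (n.-1 ^_ k)%:R / n%:R ^+ k : R) @ \oo --> (1 : R).
Proof.
elim: k => [|k IH].
  by under eq_fun do rewrite ffactn0 expr0 divr1; exact: cvg_cst.
have : (fun n => (n.-1 ^_ k)%:R / n%:R ^+ k * ((n - k.+1)%:R / n%:R) : R) @ \oo
   --> (1 * 1 : R) by apply: cvgM => //; exact: cvg_subn_ratio.
rewrite mulr1; apply: cvg_trans; apply: near_eq_cvg; near=> n.
by rewrite ffactnSr natrM exprSr invfM -subn1 -subnDA add1n; ring.
Unshelve. all: by end_near. Qed.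

(* Normalised first moment, and bound for the second moment over disjoint pairs, of
   the number of fringe copies of a fixed tree on [k] vertices. *)
Definition mom1 k n : R :=
  (n.-1 ^_ k * (n - k) ^ (n - k).-1)%:R / n%:R ^+ n.-1.
Definition mom2 k n : R :=
  (n ^ (2 * k) * (n - 2 * k) ^ (n - 2 * k))%:R / n%:R ^+ n.

Lemma cvg_mom1 k : mom1 k @ \oo --> (expR (- k%:R) : R).
Proof.
have : (fun n => (n.-1 ^_ k)%:R / n%:R ^+ k * ((n - k)%:R / n%:R) ^+ (n - k.+1) : R) @ \oo
   --> (1 * expR (- k%:R) : R).
  by apply: cvgM; [exact: cvg_ffact_ratio|exact: cvg_subn_ratio_expB].
rewrite mul1r; apply: cvg_trans; apply: near_eq_cvg; near=> n.
have kn : (k < n)%N by near: n; exact: nbhs_infty_gt.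
rewrite /mom1 natrM natrX (_ : n.-1 = k + (n - k.+1))%N; last by lia.
rewrite exprD invfM expr_div_n (_ : (n - k).-1 = n - k.+1)%N; last by lia.
by rewrite (_ : k + (n - k.+1) = n.-1)%N; [ring|lia].
Unshelve. all: by end_near. Qed.

Lemma cvg_mom2 k : mom2 k @ \oo --> (expR (- k%:R) ^+ 2 : R).
Proof.
have : (fun n => ((n - 2 * k)%:R / n%:R) ^+ (n - 2 * k) : R) @ \oo
   --> (expR (- (2 * k)%:R) : R) by exact: cvg_subn_ratio_expB.
rewrite -expRM_natl natrM mulrN; apply: cvg_trans; apply: near_eq_cvg; near=> n.
have kn : (2 * k < n)%N by near: n; exact: nbhs_infty_gt.
have nE : n%:R ^+ n = n%:R ^+ (2 * k) * n%:R ^+ (n - 2 * k) :> R.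
  by rewrite -exprD subnKC // ltnW.
rewrite /mom2 natrM !natrX nE invfM expr_div_n.
rewrite mulrACA divff ?mul1r // expf_neq0 // pnatr_eq0.
by rewrite -lt0n (leq_ltn_trans _ kn).
Unshelve. all: by end_near. Qed.

(** Let eps shrink along 1/(j + 1), moving to the next value only after the threshold for it has
    been passed. *)
Lemma cvg_diagonal (p : R -> nat -> R) :
  (forall eps, 0 < eps -> p eps @ \oo --> (1 : R)) ->
  exists2 o : nat -> R, o @ \oo --> (0 : R) & (fun n => p (o n) n) @ \oo --> (1 : R).
Proof.
move=> H; pose e j : R := j.+1%:R^-1.
have e0 j : 0 < e j by rewrite invr_gt0.
have /choice[N NP] j : exists N, forall n, (N <= n)%N -> `|1 - p (e j) n| <= e j.
  have /cvgrPdist_le/(_ _ (e0 j))[N _ HN] := H _ (e0 j).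
  by exists N => n; exact: HN.
(* Bounding j by n keeps the maximum finite and still lets [J] tend to infinity; the empty maximum
   is 0, hence the first alternative in [JP]. *)
pose J n := \max_(j < n.+1 | (N j <= n)%N) j.
have JP n : J n = 0%N \/ (N (J n) <= n)%N.
  rewrite /J; apply: (big_ind (fun m => m = 0%N \/ (N m <= n)%N)).
  - by left.
  - by move=> a b Ha Hb; case: (leqP a b) => _.
  - by move=> j Hj; right.
have Jge j n : (j <= n)%N -> (N j <= n)%N -> (j <= J n)%N.
  move=> jn Nj; have jn' : (j < n.+1)%N by [].
  exact: (@leq_bigmax_cond _ (fun i : 'I_n.+1 => (N i <= n)%N) _ (Ordinal jn')).
have o0 : (fun n => e (J n)) @ \oo --> (0 : R).
  apply/cvgr0Pnorm_le => eps eps0.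
  have /cvgr0Pnorm_le/(_ _ eps0)[M _ HM] := @cvg_harmonic R.
  near=> n; apply: HM => /=; apply: Jge; near: n; exact: nbhs_infty_ge.
exists (fun n => e (J n)) => //.
apply/cvgrPdist_le => eps eps0; near=> n.
have Jn : (0 < J n)%N.
  by apply: Jge; near: n; exact: nbhs_infty_ge.
have Nn : (N (J n) <= n)%N by case: (JP n) => // J0; rewrite J0 in Jn.
apply: le_trans (NP _ _ Nn) _; rewrite -[leLHS]gtr0_norm ?e0 //.
by near: n; have /cvgr0Pnorm_le := o0; exact.
Unshelve. all: by end_near. Qed.

End Limits.

(** * Mean-square law of large numbers *)

Section MeanSquare.
Local Open Scope classical_set_scope.
Local Open Scope ring_scope.
Variable R : realType.
Implicit Types X Y : forall n : nat, 'I_n -> {ffun 'I_n -> 'I_n} -> R.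

(** Eventually [d n] bounds the mean of the square over all parent functions, with one [d] for every
    root. Stability under finite linear combinations lets single copy counts be assembled into the
    sum of [vpsi]. *)
Definition msq_small X : Prop :=
  exists2 d : nat -> R, (d @ \oo --> (0 : R))%classic &
    \forall n \near \oo, forall r : 'I_n,
      \sum_(f in treefun r) X n r f ^+ 2 <= d n * #|treefun r|%:R.

Lemma msq_small_eq X Y : msq_small X ->
  (\forall n \near \oo, forall (r : 'I_n) f, f \in treefun r -> Y n r f = X n r f) ->
  msq_small Y.
Proof.
move=> [d d0 dX] XY; exists d => //; near=> n => r.
rewrite (eq_bigr (fun f => X n r f ^+ 2)).
  by move: r; near: n.
by move=> f fT; congr (_ ^+ 2); move: r f fT; near: n.
Unshelve. all: by end_near. Qed.

Lemma msq_small0 : msq_small (fun n r f => 0).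
Proof.
exists (fun=> 0); first exact: cvg_cst.
by near=> n => r; rewrite mul0r big1 // => f _; rewrite expr0n.
Unshelve. all: by end_near. Qed.

Lemma msq_smallD X Y : msq_small X -> msq_small Y ->
  msq_small (fun n r f => X n r f + Y n r f).
Proof.
move=> [d d0 dX] [c c0 cY]; exists (fun n => 2 * d n + 2 * c n).
  have -> : 0 = 2 * 0 + 2 * 0 :> R by ring.
  by apply: cvgD; apply: cvgM => //; exact: cvg_cst.
near=> n => r; have HX : \sum_(f in treefun r) X n r f ^+ 2 <= d n * #|treefun r|%:R.
  by move: r; near: n.
have HY : \sum_(f in treefun r) Y n r f ^+ 2 <= c n * #|treefun r|%:R.
  by move: r {HX}; near: n.
apply: (@le_trans _ _ (2 * (\sum_(f in treefun r) X n r f ^+ 2)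
                       + 2 * (\sum_(f in treefun r) Y n r f ^+ 2))).
  rewrite !mulr_sumr -big_split /=; apply: ler_sum => f _.
  by have := sqr_ge0 (X n r f - Y n r f); nra.
by rewrite [leRHS]mulrDl; apply: lerD; rewrite -mulrA ler_pM2l.
Unshelve. all: by end_near. Qed.

Lemma msq_smallZ (a : R) X : msq_small X -> msq_small (fun n r f => a * X n r f).
Proof.
move=> [d d0 dX]; exists (fun n => a ^+ 2 * d n).
  by rewrite -(mulr0 (a ^+ 2)); apply: cvgM => //; exact: cvg_cst.
near=> n => r; have HX : \sum_(f in treefun r) X n r f ^+ 2 <= d n * #|treefun r|%:R.
  by move: r; near: n.
under eq_bigr do rewrite exprMn.
by rewrite -mulr_sumr -mulrA ler_wpM2l ?sqr_ge0.
Unshelve. all: by end_near. Qed.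

Lemma msq_small_sum (I : eqType) (s : seq I) (P : pred I)
    (X : I -> forall n : nat, 'I_n -> {ffun 'I_n -> 'I_n} -> R) :
  (forall i, i \in s -> P i -> msq_small (X i)) ->
  msq_small (fun n r f => \sum_(i <- s | P i) X i n r f).
Proof.
elim: s => [|i s IH] H.
  apply: (msq_small_eq msq_small0); near=> n => r f _.
  by rewrite big_nil.
have {}IH : msq_small (fun n r f => \sum_(i <- s | P i) X i n r f).
  by apply: IH => j js; apply: H; rewrite in_cons js orbT.
have [Pi|nPi] := boolP (P i).
  have Hi := H i (mem_head _ _) Pi.
  apply: (msq_small_eq (msq_smallD Hi IH)); near=> n => r f _.
  by rewrite big_cons Pi.
apply: (msq_small_eq IH); near=> n => r f _.
by rewrite big_cons (negPf nPi).
Unshelve. all: by end_near. Qed.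

Lemma nemb_msq_small k (t : {ffun 'I_k -> 'I_k}) (rho : 'I_k) : t \in treefun rho ->
  msq_small (fun n r f => (nemb t rho f)%:R / n%:R - expR (- k%:R)).
Proof.
move=> tT; set c := expR (- k%:R).
(* The mean of (N/n - c)^2 expanded: disjoint pairs, coinciding pairs of order 1/n, cross term,
   constant. The limit is c^2 + 0 - 2c^2 + c^2 = 0. *)
exists (fun n => mom2 R k n + (k ^ k)%:R * (mom1 R k n * n%:R^-1) - 2 * c * mom1 R k n
                 + c ^+ 2).
  have -> : 0 = c ^+ 2 + (k ^ k)%:R * (c * 0) - 2 * c * c + c ^+ 2 by ring.
  apply: cvgD; last exact: cvg_cst.
  apply: cvgB; last by apply: cvgM; [exact: cvg_cst|exact: cvg_mom1].
  apply: cvgD; first exact: cvg_mom2.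
  apply: cvgM; first exact: cvg_cst.
  by apply: cvgM; [exact: cvg_mom1|exact: cvg_invn].
near=> n => r.
have kn : (2 * k < n)%N by near: n; exact: nbhs_infty_gt.
have n0 : (0 : R) < n%:R by rewrite ltr0n (leq_ltn_trans _ kn).
have nN0 : n%:R != 0 :> R by rewrite lt0r_neq0.
have ct := card_treefun r; rewrite card_ord in ct.
set tau := #|treefun r|%:R.
have ctR : n%:R * tau = n%:R ^+ n.-1 :> R by rewrite -natrM ct natrX.
have ctR2 : n%:R ^+ 2 * tau = n%:R ^+ n :> R.
  rewrite expr2 -mulrA ctR -exprS prednK // (leq_ltn_trans _ kn) //.
set S1 : R := \sum_(f in treefun r) (nemb t rho f)%:R.
set S2 : R := \sum_(f in treefun r) (nemb t rho f)%:R ^+ 2.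
have S1E : S1 = mom1 R k n * (n%:R * tau).
  rewrite /S1 -natr_sum (sum_nemb tT) !card_ord /mom1 ctR mulfVK //.
  by rewrite expf_neq0.
have S2E : S2 <= mom2 R k n * (n%:R ^+ 2 * tau) + (k ^ k)%:R * S1.
  rewrite /S2; under eq_bigr do rewrite -natrX.
  rewrite -natr_sum.
  have := @nemb_sqr_le _ 'I_n t rho r tT; rewrite !card_ord => /(_ kn).
  rewrite -(ler_nat R) natrD !natrM !natr_sum => /le_trans; apply.
  by rewrite ctR2 /mom2 mulfVK ?expf_neq0 // natrM !natrX.
have -> : \sum_(f in treefun r) ((nemb t rho f)%:R / n%:R - c) ^+ 2 =
    S2 / n%:R ^+ 2 - 2 * c * (S1 / n%:R) + c ^+ 2 * tau.
  rewrite /S2 /S1 /tau -sumr_const !mulr_suml !mulr_sumr -sumrB -big_split /=.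
  by apply: eq_bigr => f _; field.
have S2E' : S2 / n%:R ^+ 2 <= mom2 R k n * tau + (k ^ k)%:R * (mom1 R k n * n%:R^-1) * tau.
  rewrite ler_pdivrMr ?exprn_gt0 //; apply: le_trans S2E _; rewrite S1E.
  by rewrite le_eqVlt; apply/orP; left; apply/eqP; field.
apply: (@le_trans _ _ (mom2 R k n * tau + (k ^ k)%:R * (mom1 R k n * n%:R^-1) * tau
                       - 2 * c * (S1 / n%:R) + c ^+ 2 * tau)).
  by rewrite !lerD2r.
by rewrite S1E le_eqVlt; apply/orP; left; apply/eqP; field.
Unshelve. all: by end_near. Qed.

End MeanSquare.

Lemma sum_by_size (M : nmodType) (V : finType) (s : V -> nat) (F : V -> M) (m : nat) :
  (forall v, 0 < s v)%N -> (forall v, (m < s v)%N -> F v = 0) ->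
  \sum_v F v = \sum_(1 <= k < m.+1) \sum_(v | s v == k) F v.
Proof.
move=> s0 sF; under [RHS]eq_bigr do rewrite big_mkcond.
rewrite exchange_big /=; apply: eq_bigr => v _.
rewrite -big_mkcond /=; under eq_bigl do rewrite eq_sym.
rewrite big_nat1_eq s0 ltnS /=; case: leqP => // /sF ->.
by [].
Qed.

(** * The bounding functional and its limit *)

Section Functional.
Variables (R : realType) (K Kh : nat).
Hypotheses (K0 : (0 < K)%N) (KKh : (K < Kh)%N).

Definition lratio (s : nat) : R := ln ((s%:R + 1) / s%:R).

(* Upper bound for the contribution [ln (g / (g - 1))] of a vertex whose fringe
   subtree has [k] vertices, [s] subtrees through the root and root degree [c]. *)
Definition psi (k s c : nat) : R :=
  if (k <= K)%N then lratio s
  else if (k <= Kh)%N then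
    if c == 1%N then lratio k else ln ((2 * k%:R - 1) / (2 * k%:R - 2))
  else lratio Kh.

Definition vpsi (V : finType) (f : {ffun V -> V}) (v : V) : R :=
  psi #|fringe f v| #|rsub f v| #|children f v|.

Definition sum_shapes (k : nat) (F : forall rho : 'I_k, {ffun 'I_k -> 'I_k} -> R) : R :=
  \sum_(rho : 'I_k) \sum_(t in treefun rho) F rho t.

Lemma lratio_le a s : (0 < a)%N -> (a <= s)%N -> lratio s <= lratio a.
Proof.
move=> a0 as_; have s0 := leq_trans a0 as_.
rewrite ler_ln ?posrE ?divr_gt0 ?addr_gt0 ?ltr0n //.
rewrite !mulrDl !divff ?pnatr_eq0 -?lt0n // !mul1r lerD2l lef_pV2 ?posrE ?ltr0n //.
by rewrite ler_nat.
Qed.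

Lemma lratio_vpsi (V : finType) (r : V) f v :
  f \in treefun r -> lratio #|rsub f v| <= vpsi f v.
Proof.
move=> fT; rewrite /vpsi /psi.
have f0 : (0 < #|fringe f v|)%N by apply/card_gt0P; exists v; exact: fringe_id.
case: leqP => // Kf; case: leqP => [_|Khf].
  case: eqP => [_|/eqP c1]; first by apply: lratio_le => //; exact: card_fringe_rsub fT _.
  have := card_fringe_rsub2 fT c1; case: #|fringe f v| Kf {f0} => // k Kk /= ks.
  have k0 : (0 < k)%N by lia.
  apply: le_trans (lratio_le _ ks) _; first by rewrite muln_gt0.
  rewrite /lratio le_eqVlt; apply/orP; left; apply/eqP; congr ln.
  by rewrite natrM -natr1; congr (_ / _); ring.
apply: lratio_le; first by lia.
by apply: leq_trans (ltnW Khf) _; exact: card_fringe_rsub fT _.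
Qed.

Lemma num_subtrees_le (V : finType) (r : V) f :
  f \in treefun r ->
  (num_subtrees (edges r f))%:R <= #|V|%:R * expR (\sum_v vpsi f v).
Proof.
move=> fT.
apply: (@le_trans _ _ (#|V|%:R * (#|rsub f r|.+1)%:R)).
  rewrite -natrM ler_nat; apply: leq_trans (num_subtrees_edges fT) _.
  by rewrite leq_mul2l leqnSn orbT.
rewrite ler_wpM2l //.
have s0 v : 0 < #|rsub f v|%:R :> R by rewrite ltr0n (rsub_gt0 fT).
have -> : #|rsub f r|.+1%:R = \prod_v ((#|rsub f v|%:R + 1) / #|rsub f v|%:R) :> R.
  have P0 : \prod_v #|rsub f v|%:R != 0 :> R.
    by rewrite prodf_seq_neq0; apply/allP => v _; rewrite lt0r_neq0.
  rewrite prodf_div; apply: (mulIf P0); rewrite mulfVK //.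
  under [RHS]eq_bigr do rewrite natr1.
  by rewrite -!natr_prod -natrM mulnC (prod_rsub fT).
apply: (@le_trans _ _ (expR (\sum_v lratio #|rsub f v|))).
  rewrite expR_sum le_eqVlt; apply/orP; left; apply/eqP.
  by apply: eq_bigr => v _; rewrite lnK // posrE divr_gt0 // addr_gt0.
by rewrite ler_expR; apply: ler_sum => v _; exact: lratio_vpsi fT.
Qed.

Definition tpsi (k : nat) (rho : 'I_k) (t : {ffun 'I_k -> 'I_k}) : R :=
  psi k #|rsub t rho| #|children t rho|.

(** Subtracting [lratio Kh] at every vertex kills the terms with more than [Kh] descendants, so
    finitely many shapes remain. The root, excluded by [sum_femb], is among those killed because n >
    [Kh]. *)
Lemma sum_vpsi n (r : 'I_n) f : (Kh < n)%N -> f \in treefun r ->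
  \sum_v vpsi f v = lratio Kh * n%:R +
    \sum_(1 <= k < Kh.+1) k`!%:R^-1 *
      sum_shapes (fun (rho : 'I_k) t => (tpsi rho t - lratio Kh) * (nemb t rho f)%:R).
Proof.
move=> Khn fT.
have -> : lratio Kh * n%:R = \sum_(v : 'I_n) lratio Kh.
  by rewrite sumr_const card_ord mulr_natr.
apply/eqP; rewrite addrC -subr_eq -sumrB; apply/eqP.
rewrite (@sum_by_size _ _ (fun v => #|fringe f v|) _ Kh); first last.
- move=> v Kv; rewrite /vpsi /psi (leqNgt _ K) (leqNgt _ Kh).
  by rewrite Kv (ltn_trans KKh Kv) /= subrr.
- by move=> v; apply/card_gt0P; exists v; exact: fringe_id.
apply: eq_big_nat => k /andP[k1 kK].
have k0 : k`!%:R != 0 :> R by rewrite pnatr_eq0 -lt0n fact_gt0.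
apply: (mulfI k0); rewrite mulrA mulfV // mul1r.
have -> : \sum_(v | #|fringe f v| == k) (vpsi f v - lratio Kh) =
   \sum_(v | (v != r) && (#|fringe f v| == k)) (vpsi f v - lratio Kh).
  apply: eq_bigl => v; have [->|//] := eqVneq v r.
  have -> : fringe f r = setT.
    by apply/setP => x; rewrite in_setT (treefun_fringe fT).
  by rewrite cardsT card_ord; apply/eqP => nk; move: Khn; rewrite nk ltnNge -ltnS kK.
have := sum_femb 'I_k (fun v => vpsi f v - lratio Kh) fT.
rewrite [in RHS]card_ord mulr_natl => <-.
apply: eq_bigr => rho _; apply: eq_bigr => t tT.
rewrite /nemb mulr_natr -sumr_const; apply: eq_big => [iota|iota e]; first by rewrite inE.
rewrite /vpsi /tpsi (card_femb_fringe tT e) (card_femb_children e).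
by rewrite (card_femb_rsub tT fT e) card_ord.
Qed.

(** The expression of [sum_vpsi] divided by n, with each copy count over n replaced by its limit. *)
Definition lim_psi : R := lratio Kh +
  \sum_(1 <= k < Kh.+1) k`!%:R^-1 *
      sum_shapes (fun (rho : 'I_k) t => (tpsi rho t - lratio Kh) * expR (- k%:R)).

Lemma vpsi_msq_small :
  msq_small (fun n r f => (\sum_v vpsi f v) / n%:R - lim_psi).
Proof.
pose X k n (r : 'I_n) (f : {ffun 'I_n -> 'I_n}) : R := k`!%:R^-1 * sum_shapes (fun (rho : 'I_k) t =>
  (tpsi rho t - lratio Kh) * ((nemb t rho f)%:R / n%:R - expR (- k%:R))).
have HX : msq_small (fun n r f => \sum_(1 <= k < Kh.+1) X k n r f).
  apply: msq_small_sum => k _ _; apply: msq_smallZ.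
  apply: msq_small_sum => rho _ _; apply: msq_small_sum => t _ tT.
  by apply: msq_smallZ; exact: nemb_msq_small.
apply: (msq_small_eq HX); near=> n => r f fT.
have Kn : (Kh < n)%N by near: n; exact: nbhs_infty_gt.
have nN0 : n%:R != 0 :> R by rewrite pnatr_eq0 -lt0n (leq_ltn_trans _ Kn).
rewrite (sum_vpsi Kn fT) /lim_psi mulrDl mulfK // opprD addrACA subrr add0r.
rewrite mulr_suml -sumrB; apply: eq_bigr => k _.
rewrite /X -mulrA -mulrBr; congr (_ * _).
rewrite /sum_shapes mulr_suml -sumrB; apply: eq_bigr => rho _.
rewrite mulr_suml -sumrB; apply: eq_bigr => t _.
by rewrite -mulrA -mulrBr.
Unshelve. all: by end_near. Qed.

End Functional.

(** * The constants *)

Section Constants.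
Variable R : realType.

Lemma ln_prod (I : Type) (s : seq I) (P : pred I) (F : I -> R) :
  (forall i, 0 < F i) -> ln (\prod_(i <- s | P i) F i) = \sum_(i <- s | P i) ln (F i).
Proof.
move=> F0; rewrite -[RHS]expRK expR_sum; congr ln.
by apply: eq_bigr => i _; rewrite lnK // posrE.
Qed.

Lemma powR_expR (a x : R) : 0 < a -> a `^ x = expR (x * ln a).
Proof. by move=> a0; rewrite /powR gt_eqF. Qed.

(* Grouping the children of the root by the shape of their fringe subtrees: the
   remaining [l - k] vertices carry an arbitrary rooted tree. *)
Lemma sum_shapes_rsub (l : nat) : (0 < l)%N ->
  sum_shapes (fun (rho : 'I_l) u => ln (#|rsub u rho|%:R : R)) =
  \sum_(1 <= k < l) ('C(l, k) * (l - k) ^ (l - k).-1)%:R *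
    sum_shapes (fun (rho : 'I_k) t => ln (#|rsub t rho|.+1%:R : R)).
Proof.
move=> l0.
pose F (r : 'I_l) (u : {ffun 'I_l -> 'I_l}) w : R :=
  if (w != r) && (u w == r) then ln #|rsub u w|.+1%:R else 0.
have one (r : 'I_l) (u : {ffun 'I_l -> 'I_l}) : u \in treefun r ->
    ln (#|rsub u r|%:R : R) = \sum_(1 <= k < l) k`!%:R^-1 *
      sum_shapes (fun (rho : 'I_k) t => ln (#|rsub t rho|.+1%:R : R) *
        #|[set iota | femb t rho u iota & u (iota rho) == r]|%:R).
  move=> uT.
  have -> : ln (#|rsub u r|%:R : R) = \sum_w F r u w.
    rewrite (card_rsub uT) natr_prod ln_prod; last by move=> i; rewrite ltr0n.
    by rewrite big_mkcond /=; apply: eq_bigr => w _; rewrite /F inE.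
  rewrite (@sum_by_size _ _ (fun w => #|fringe u w|) _ l.-1); first last.
  - move=> w lw; rewrite /F; case: ifP => // /andP[wr uw].
    have : w \in children u r by rewrite inE wr.
    move/(card_fringe_child uT); have := max_card (mem (fringe u r)).
    by rewrite card_ord => lr wl; move: lw; rewrite prednK // leqNgt (leq_trans wl lr).
  - by move=> v; apply/card_gt0P; exists v; exact: fringe_id.
  rewrite prednK //; apply: eq_big_nat => k /andP[k1 kl].
  have k0 : k`!%:R != 0 :> R by rewrite pnatr_eq0 -lt0n fact_gt0.
  apply: (mulfI k0); rewrite mulrA mulfV // mul1r.
  have -> : \sum_(v | #|fringe u v| == k) F r u v =
     \sum_(v | (v != r) && (#|fringe u v| == k)) F r u v.
    rewrite [LHS]big_mkcond [RHS]big_mkcond; apply: eq_bigr => v _.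
    by rewrite /F; have [->|//] := eqVneq v r; case: ifP.
  have := sum_femb 'I_k (F r u) uT.
  rewrite !card_ord mulr_natl => <-.
  apply: eq_bigr => rho _; apply: eq_bigr => t tT.
  rewrite mulr_natr -sumr_const [RHS]big_mkcond [LHS]big_mkcond /=.
  apply: eq_bigr => iota _; rewrite inE; case: ifP => //= e.
  rewrite /F (card_femb_rsub tT uT e).
  have -> : iota rho != r.
    by apply: contraNneq (femb_root tT uT e) => <-; exact: mem_img.
  by [].
rewrite /sum_shapes; under eq_bigr => r _ do rewrite (eq_bigr _ (one r)).
under eq_bigr => r _ do rewrite exchange_big /=.
rewrite exchange_big /=; apply: eq_big_nat => k /andP[k1 kl].
(* Division by k! turns the injections into choices of a vertex set for the child's fringe
   subtree. *)
have cE : ('C(l, k) * (l - k) ^ (l - k).-1)%:R =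
    k`!%:R^-1 * (l ^_ k * (l - k) ^ (l - k).-1)%:R :> R.
  rewrite -bin_ffact mulnAC [in RHS]natrM [RHS]mulrC mulfK //.
rewrite cE -mulrA; under eq_bigr => r _ do rewrite -mulr_sumr.
rewrite -mulr_sumr; congr (_ * _).
rewrite mulr_sumr /sum_shapes.
under eq_bigr => r _ do rewrite exchange_big /=.
rewrite exchange_big /=; apply: eq_bigr => rho _.
under eq_bigr => r _ do rewrite exchange_big /=.
rewrite exchange_big /= mulr_sumr; apply: eq_bigr => t tT.
have := @sum_nemb_at_root _ 'I_l t rho tT; rewrite !card_ord => /(_ kl) <-.
rewrite natr_sum mulr_suml; apply: eq_bigr => r _.
by rewrite natr_sum mulr_suml; apply: eq_bigr => u _; rewrite mulrC.
Qed.

Lemma card_shapes (k : nat) (a : R) : (0 < k)%N ->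
  sum_shapes (fun (rho : 'I_k) t => a) = a * (k ^ k.-1)%:R.
Proof.
move=> k0; have := @card_rooted_treefun 'I_k; rewrite card_ord => /(_ k0) <-.
rewrite natr_sum mulr_sumr; apply: eq_bigr => rho _.
by rewrite sumr_const mulr_natr.
Qed.

Lemma card_shapes1 (k : nat) (a b : R) : (1 < k)%N ->
  sum_shapes (fun (rho : 'I_k) t => if #|children t rho| == 1%N then a else b) =
  a * (k * k.-1 ^ (k - 2))%:R + b * ((k ^ k.-1)%:R - (k * k.-1 ^ (k - 2))%:R).
Proof.
move=> k1.
have -> : sum_shapes (fun (rho : 'I_k) t => if #|children t rho| == 1%N then a else b) =
  sum_shapes (fun (rho : 'I_k) t => b) +
  (a - b) * \sum_(rho : 'I_k) #|[set t in treefun rho | #|children t rho| == 1%N]|%:R.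
  rewrite /sum_shapes mulr_sumr -big_split /=; apply: eq_bigr => rho _.
  have -> : (a - b) * #|[set t in treefun rho | #|children t rho| == 1%N]|%:R =
    \sum_(t in treefun rho) (if #|children t rho| == 1%N then a - b else 0).
    rewrite mulr_natr -sumr_const -big_mkcondr /=; apply: eq_bigl => t.
    by rewrite in_set.
  rewrite -big_split /=; apply: eq_bigr => t _; case: ifP => _; ring.
rewrite card_shapes; last exact: ltnW.
rewrite -natr_sum card_rooted_treefun1 ?card_ord //.
by ring.
Qed.

Lemma sum_rooted_trees (k : nat) (F : {set {set 'I_k}} -> 'I_k -> R) :
  \sum_(Tv in rooted_trees k) F Tv.1 Tv.2 =
  sum_shapes (fun (rho : 'I_k) t => F (edges rho t) rho).
Proof.
have tE (rho : 'I_k) : trees k = edges rho @: treefun rho.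
  apply/setP => E; rewrite inE; apply/asboolP/imsetP => [/(edges_surj rho)[t tT <-]|[t tT ->]].
    by exists t.
  exact: edges_is_tree.
rewrite (eq_bigl (fun Tv : {set {set 'I_k}} * 'I_k => (Tv.1 \in trees k) && true)); last first.
  by move=> Tv; rewrite in_set andbT.
rewrite -(pair_big (fun E => E \in trees k) xpredT (fun E v => F E v)) /= exchange_big /=.
apply: eq_bigr => rho _; rewrite (tE rho) big_imset //=.
exact: edges_inj.
Qed.

Lemma exchange_triangle (K : nat) (a : nat -> nat -> R) :
  \sum_(1 <= l < K.+1) \sum_(1 <= k < l) a l k =
  \sum_(1 <= k < K.+1) \sum_(k.+1 <= l < K.+1) a l k.
Proof.
elim: K => [|K IH]; first by rewrite !big_geq.
rewrite big_nat_recr //= IH [RHS]big_nat_recr //= [X in _ = _ + X]big_geq // addr0.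
rewrite -big_split /=; apply: eq_big_nat => k /andP[k1 kK].
by rewrite [RHS]big_nat_recr.
Qed.

Section Evaluation.
Variables (K Kh : nat).
Hypotheses (K0 : (0 < K)%N) (KKh : (K < Kh)%N).

Let wt (k : nat) : R := expR (- k%:R) / k`!%:R.

(** The subtracted copies of [lratio Kh] number k^(k-1) for each size k, with weight e^(-k)/k!;
    together they give the sum in [hfun]. *)
Lemma lim_psiE : lim_psi R K Kh = lratio R Kh * hfun R Kh +
  \sum_(1 <= k < Kh.+1) wt k * sum_shapes (fun (rho : 'I_k) t => tpsi R K Kh rho t).
Proof.
rewrite /lim_psi /hfun mulrBr mulr1 -addrA; congr (_ + _).
rewrite mulr_sumr -sumrN -big_split /=; apply: eq_big_nat => k /andP[k1 _].
have k0 : k%:R != 0 :> R by rewrite pnatr_eq0 -lt0n.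
have kf0 : k`!%:R != 0 :> R by rewrite pnatr_eq0 -lt0n fact_gt0.
have -> : sum_shapes (fun (rho : 'I_k) t =>
      (tpsi R K Kh rho t - lratio R Kh) * expR (- k%:R)) =
    expR (- k%:R) * (sum_shapes (fun (rho : 'I_k) t => tpsi R K Kh rho t)
                     - sum_shapes (fun (rho : 'I_k) t => lratio R Kh)).
  rewrite /sum_shapes -sumrB mulr_sumr; apply: eq_bigr => rho _.
  by rewrite -sumrB mulr_sumr; apply: eq_bigr => t _; rewrite mulrC.
rewrite card_shapes // expr_div_n -expRM_natl mulr1 /wt expRN natrX.
have -> : k%:R ^+ k = k%:R * k%:R ^+ k.-1 :> R by rewrite -exprS prednK.
by field; rewrite k0 kf0 gt_eqF ?expR_gt0.
Qed.

Lemma xi1E : xi1 R Kh = expR (lratio R Kh * hfun R Kh).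
Proof.
have Kh0 : 0 < Kh%:R :> R by rewrite ltr0n (leq_ltn_trans _ KKh).
by rewrite /xi1 powR_expR ?divr_gt0 ?addr_gt0 // mulrC.
Qed.

Lemma xi23E : xi2 R K Kh * xi3 R K Kh = expR (\sum_(K.+1 <= k < Kh.+1)
  wt k * sum_shapes (fun (rho : 'I_k) t => tpsi R K Kh rho t)).
Proof.
rewrite /xi2 /xi3 -big_split expR_sum /=; apply: eq_big_nat => k /andP[Kk kKh].
have k1 : (1 < k)%N by rewrite (leq_trans _ Kk).
have k1R : 1 < k%:R :> R by rewrite ltr1n.
have -> : sum_shapes (fun (rho : 'I_k) t => tpsi R K Kh rho t) =
   sum_shapes (fun (rho : 'I_k) t => if #|children t rho| == 1%N then lratio R k
     else ln ((2 * k%:R - 1) / (2 * k%:R - 2))).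
  apply: eq_bigr => rho _; apply: eq_bigr => t _; rewrite /tpsi /psi.
  by rewrite leqNgt Kk /= -ltnS kKh.
rewrite card_shapes1 // !powR_expR; first last.
- by apply: divr_gt0; lra.
- by apply: divr_gt0; lra.
rewrite -expRD; congr expR; rewrite /wt /lratio natrM !natrX.
have -> : k.-1%:R = k%:R - 1 :> R by rewrite -subn1 natrB // ltnW.
by rewrite subn1; field; rewrite pnatr_eq0 -lt0n fact_gt0.
Qed.

(** For small trees [lratio] is ln g - ln s. [sum_shapes_rsub] rewrites ln s through ln g of smaller
    trees, and exchanging the two summations collects the coefficient [fK] in front of each ln g. *)
Lemma xi4E : xi4 R K = expR (\sum_(1 <= k < K.+1)
  wt k * sum_shapes (fun (rho : 'I_k) t => tpsi R K Kh rho t)).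
Proof.
pose G k := sum_shapes (fun (rho : 'I_k) t => ln (#|rsub t rho|.+1%:R : R)).
have -> : xi4 R K = expR (\sum_(1 <= k < K.+1) fK R K k * G k).
  rewrite /xi4 expR_sum; apply: eq_bigr => k _.
  have -> : \prod_(Tv in rooted_trees k)
      (num_rooted_subtrees Tv.1 Tv.2)%:R `^ fK R K k =
    expR (\sum_(Tv in rooted_trees k)
      fK R K k * ln ((num_rooted_subtrees Tv.1 Tv.2)%:R : R)).
    rewrite expR_sum; apply: eq_bigr => Tv _; rewrite powR_expR //.
    by rewrite ltr0n /num_rooted_subtrees addn1.
  rewrite -mulr_sumr (sum_rooted_trees (fun E v => ln (num_rooted_subtrees E v)%:R)).
  congr (expR (_ * _)); apply: eq_bigr => rho _; apply: eq_bigr => t tT.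
  by rewrite num_rooted_subtrees_edges.
congr expR.
transitivity (\sum_(1 <= l < K.+1) wt l * G l -
  \sum_(1 <= l < K.+1) \sum_(1 <= k < l)
    wt l * (('C(l, k) * (l - k) ^ (l - k).-1)%:R * G k)).
  rewrite exchange_triangle -sumrB; apply: eq_bigr => k _.
  rewrite /fK mulrBl mulr_suml; congr (_ - _); apply: eq_big_nat => l /andP[kl _].
  rewrite bin_sub; last exact: ltnW.
  by rewrite subn1 natrM natrX /wt; ring.
rewrite -sumrB; apply: eq_big_nat => l /andP[l1 lK].
rewrite -mulr_sumr -mulrBr; congr (_ * _); rewrite -sum_shapes_rsub //.
rewrite /G /sum_shapes -sumrB; apply: eq_bigr => rho _; rewrite -sumrB.
apply: eq_bigr => t tT; rewrite /tpsi /psi -ltnS lK /lratio.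
have s0 : 0 < #|rsub t rho|%:R :> R by rewrite ltr0n (rsub_gt0 tT).
by rewrite ln_div ?posrE ?addr_gt0 // natr1.
Qed.

Lemma expR_lim_psi :
  expR (lim_psi R K Kh) = xi1 R Kh * xi2 R K Kh * xi3 R K Kh * xi4 R K.
Proof.
rewrite -(mulrA (xi1 _ _)) xi23E xi1E xi4E -!expRD lim_psiE -addrA; congr (expR (_ + _)).
by rewrite addrC [LHS](@big_cat_nat _ _ _ K.+1) //= ltnW.
Qed.

End Evaluation.
End Constants.

(** * Subtrees of a random tree *)

Section Main.
Variable R : realType.

Lemma card_trees_treefun (n : nat) (r : 'I_n) (A : pred {set {set 'I_n}}) :
  #|[set E in trees n | A E]| = #|[set f in treefun r | A (edges r f)]|.
Proof.
rewrite -(card_in_imset (f := edges r)); last first.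
  by move=> f h; rewrite !in_set => /andP[fT _] /andP[hT _]; exact: edges_inj.
apply: eq_card => E; rewrite in_set; apply/andP/imsetP.
  rewrite inE => -[/asboolP/(edges_surj r)[f fT fE] AE].
  by exists f; rewrite // in_set fT fE.
case=> f; rewrite in_set => /andP[fT Af] ->; split=> //.
by rewrite inE; apply/asboolP; exact: edges_is_tree.
Qed.

Lemma tree_prob_le1 (n : nat) (A : pred {set {set 'I_n}}) : tree_prob R A <= 1.
Proof.
rewrite /tree_prob; have [->|t0] := posnP #|trees n|.
  by rewrite invr0 mulr0 ler01.
rewrite ler_pdivrMr ?ltr0n // mul1r ler_nat; apply: subset_leq_card.
by apply/subsetP => E; rewrite in_set => /andP[].
Qed.

(** Chebyshev's inequality, one-sided: each tree violating [A] contributes more than eta^2 to the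
    sum of squares. *)
Lemma tree_prob_chebyshev (n : nat) (r : 'I_n) (A : pred {set {set 'I_n}})
    (X : {ffun 'I_n -> 'I_n} -> R) (d eta : R) : 0 < eta ->
  \sum_(f in treefun r) X f ^+ 2 <= d * #|treefun r|%:R ->
  (forall f, f \in treefun r -> X f <= eta -> A (edges r f)) ->
  1 - d / eta ^+ 2 <= tree_prob R A.
Proof.
move=> eta0 dX XA; rewrite /tree_prob (card_trees_treefun r).
have -> : #|trees n| = #|treefun r|.
  rewrite -(_ : #|[set E in trees n | xpredT E]| = #|trees n|).
    by rewrite (card_trees_treefun r); apply: eq_card => f; rewrite in_set andbT.
  by apply: eq_card => E; rewrite in_set andbT.
set tau := #|treefun r| in dX *; set good := #|_|.
have tau0 : (0 < tau)%N.
  have n0 : (0 < n)%N := leq_ltn_trans (leq0n r) (ltn_ord r).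
  have := card_treefun r; rewrite card_ord -/tau => tE.
  have : (0 < n * tau)%N by rewrite tE expn_gt0 n0.
  by rewrite muln_gt0 => /andP[].
rewrite ler_pdivlMr ?ltr0n // mulrBl mul1r lerBlDr -lerBlDl.
have split : tau = (good + #|[set f in treefun r | ~~ A (edges r f)]|)%N.
  rewrite /tau -(cardsID [set f | A (edges r f)]); congr (_ + _)%N; apply: eq_card => f.
    by rewrite !in_set.
  by rewrite !in_set andbC.
rewrite {1}split natrD addrAC subrr add0r.
rewrite mulrAC ler_pdivlMr ?exprn_gt0 //; apply: le_trans dX.
rewrite mulrC mulr_natr -sumr_const.
rewrite [leRHS](bigID (fun f => A (edges r f))) /= -[leLHS]add0r; apply: lerD.
  by apply: sumr_ge0 => f _; exact: sqr_ge0.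
rewrite (eq_bigl (fun f => (f \in treefun r) && ~~ A (edges r f))); last first.
  by move=> f; rewrite in_set.
apply: ler_sum => f /andP[fT nA].
have : eta < X f by rewrite ltNge; apply: contra nA; exact: XA.
by move=> eX; rewrite lerXn2r ?nnegrE ?ltW // (lt_trans eta0).
Qed.

(** The quadratic term of the exponential suffices once n >= 2/eta^2. This absorbs the factor n from
    [num_subtrees_le]. *)
Lemma natr_le_expR (eta : R) : 0 < eta ->
  (\forall n \near \oo, n%:R <= expR (n%:R * eta) :> R)%classic.
Proof.
move=> eta0; near=> n.
have n2 : 2 / eta ^+ 2 <= n%:R :> R by near: n; exact: nbhs_infty_ger.
have x0 : 0 <= n%:R * eta by rewrite mulr_ge0 // ltW.
apply: le_trans (expR_ge1Dxn 1 x0).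
rewrite ler_pdivrMr ?exprn_gt0 // in n2.
have n0 : 0 <= n%:R :> R by [].
rewrite (_ : 2`!%:R = 2 :> R) // exprMn; nra.
Unshelve. all: by end_near. Qed.

Lemma aas_num_subtrees (K Kh : nat) (eps : R) : (0 < K)%N -> (K < Kh)%N -> 0 < eps ->
  aas R (fun (n : nat) (T : {set {set 'I_n}}) =>
    (num_subtrees T)%:R <= (expR (lim_psi R K Kh) + eps) ^+ n).
Proof.
move=> K0 KKh eps0; set L := lim_psi R K Kh.
set M := expR L + eps; have M0 : 0 < M by rewrite addr_gt0 ?expR_gt0.
(* Half of the gap in the exponent: one [eta] pays for the deviation of the mean of [vpsi], the
   other for the factor n. *)
pose eta := (ln M - L) / 2.
have eta0 : 0 < eta.
  by rewrite divr_gt0 // subr_gt0 -ltr_expR lnK ?posrE // ltrDl.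
have ME : M = expR (L + eta + eta).
  rewrite -addrA (_ : eta + eta = ln M - L); last by rewrite /eta; field.
  by rewrite addrC subrK lnK ?posrE.
have [d d0 dX] := @vpsi_msq_small R K Kh KKh.
have lo : ((fun n => 1 - d n / eta ^+ 2) @ \oo --> (1 : R))%classic.
  have : ((fun n => 1 - d n / eta ^+ 2) @ \oo --> (1 - 0 / eta ^+ 2 : R))%classic.
    apply: cvgB; first exact: cvg_cst.
    by apply: cvgM => //; exact: cvg_cst.
  by rewrite mul0r subr0.
apply: (squeeze_cvgr _ lo (cvg_cst (1 : R))); near=> n.
apply/andP; split; last exact: tree_prob_le1.
have n0 : (0 < n)%N by near: n; exact: nbhs_infty_gt.
have nN0 : 0 < n%:R :> R by rewrite ltr0n.
have nle : n%:R <= expR (n%:R * eta) by near: n; exact: natr_le_expR.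
pose r := Ordinal n0.
apply: (@tree_prob_chebyshev _ r _ (fun f => (\sum_v vpsi R K Kh f v) / n%:R - L) _ _ eta0).
  by move: (r); near: n.
move=> f fT; rewrite lerBlDr ler_pdivrMr // => le /=.
apply: le_trans (num_subtrees_le R K0 KKh fT) _; rewrite card_ord.
apply: (@le_trans _ _ (expR (n%:R * eta) * expR ((eta + L) * n%:R))).
  by apply: ler_pM; rewrite ?expR_ge0 ?ler_expR.
rewrite -expRD ME -expRM_natl ler_expR le_eqVlt; apply/orP; left; apply/eqP.
by ring.
Unshelve. all: by end_near. Qed.

End Main.

Theorem theorem2p8 (R : realType) (K Kh : nat)
  (hK : (0 < K)%N) (hKKh : (K < Kh)%N) :
  exists2 o1 : nat -> R,
    (o1 @ \oo --> (0 : R))%classic &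
    aas R (fun (n : nat) (T : {set {set 'I_n}}) =>
      (num_subtrees T)%:R <=
        (xi1 R Kh * xi2 R K Kh * xi3 R K Kh * xi4 R K + o1 n) ^+ n).
Proof.
pose p eps n := tree_prob R (fun T : {set {set 'I_n}} =>
  (num_subtrees T)%:R <= (expR (lim_psi R K Kh) + eps) ^+ n).
have [err err0 perr] : exists2 o : nat -> R, (o @ \oo --> (0 : R))%classic &
    ((fun n => p (o n) n) @ \oo --> (1 : R))%classic.
  by apply: cvg_diagonal => eps eps0; exact: aas_num_subtrees.
by exists err => //; rewrite -expR_lim_psi.
Qed.
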